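(* Let $\mathcal A$ be a homogeneous constant-coefficient linear PDE operator of order $k$ on $\mathbb R^d$, from $V$ to $W$, let $L\subset V$ be a linear subspace with $L\cap\Lambda_{\mathcal A}=\{0_V\}$, let $p\in[1,\frac d{d-k})$ if $k<d$ and $p\in[1,\infty)$ if $k\ge d$, let $\Omega\subset\mathbb R^d$ be open, and let $\Omega'\Subset\Omega$ be a compactly contained Lipschitz subdomain. Let $\varepsilon=\varepsilon(p,d,\mathcal A,L,\Omega')>0$ be a constant with the following property (P) (such a constant exists by the higher integrability theorem recalled in the context): whenever $\mu\in\mathcal M(\Omega;V)$ satisfies $\mathcal A\mu=\sigma\in\mathcal M(\Omega;W)$ in $\mathcal D'(\Omega;W)$ and $\frac{\mathrm d\mu}{\mathrm d|\mu|}\in\mathcal K$ $|\mu|$-a.e. for a convex cone $\mathcal K\subset V$ with $\operatorname{dist}(\mathcal K\cap S_V,L)\le\varepsilon$, then $\mu\in L^p(\Omega';V)$ and $\|\mu\|_{L^p(\Omega')}\le C(|\mu|(\Omega)+|\sigma|(\Omega))$ with $C$ independent of $\mu$, $\sigma$ and $\mathcal K$. Let $(\mu_j)_{j\in\mathbb N}\subset\mathcal M(\Omega;V)$ satisfy $\mathcal A\mu_j=\sigma_j$ in $\mathcal D'(\Omega;W)$, with $\sigma_j\in\mathcal M(\Omega;W)$, and $$\sup_{j\in\mathbb N}\big\{|\mu_j|(\Omega)+|\sigma_j|(\Omega)\big\}<\infty.$$ Assume further that, for every $j$, $$\frac{\mathrm d\mu_j}{\mathrm d|\mu_j|}(x)\in\mathcal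 K\qquad\text{for $|\mu_j|$-almost every }x\in\Omega,$$ for some convex cone $\mathcal K\subset V$ such that $\operatorname{dist}(\mathcal K\cap S_V,L)\le\varepsilon$. Then: (i) $(\mu_j)\subset L^p(\Omega';V)$, and $\{|\mu_j|^q\}_j$ is equiintegrable on $\Omega'$ for all $1\le q<p$. (ii) If $\mu_j\overset{*}{\rightharpoonup}\mu$ as measures, then $\mu_j\rightharpoonup\mu$ weakly in $L^q(\Omega';V)$, for all $1\le q<p$. (iii) If $\mu_j\to\mu$ in measure (as maps), or $\mu_j\to\mu$ almost everywhere (as maps), then $\mu_j\to\mu$ strongly in $L^q(\Omega';V)$, for all $1\le q<p$.
   Context: $V,W$ are finite-dimensional (real) inner product spaces. A homogeneous constant-coefficient linear PDE operator of order $k$ from $V$ to $W$ acts by $\mathcal A u=\sum_{|\alpha|=k}A_\alpha\partial^\alpha u$ with $A_\alpha\in\mathrm{Lin}(V,W)$. Its principal symbol is $\mathbb A(\xi)=(2\pi\mathrm i)^k\sum_{|\alpha|=k}A_\alpha\xi^\alpha$, $\xi\in\mathbb R^d$. The wave cone of $\mathcal A$ is $\Lambda_{\mathcal A}=\bigcup_{|\xi|=1}\ker\mathbb A(\xi)\subset V$ (the kernel being taken in $V$). $\mathcal M(\Omega;V)$ is the space of finite $V$-valued Radon measures on $\Omega$; $|\mu|$ is the total variation measure and $\frac{\mathrm d\mu}{\mathrm d|\mu|}$ the polar of $\mu$. $S_V=\{v\in V: v\cdot v=1\}$. The condition $\operatorname{dist}(\mathcal K\cap S_V,L)\le\varepsilon$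 means that every $v\in\mathcal K\cap S_V$ satisfies $\operatorname{dist}(v,L)\le\varepsilon$. A Lipschitz subdomain is an open, bounded, connected set with Lipschitz boundary. Higher integrability theorem: for $\mathcal A,L,p,\Omega,\Omega'$ as in the claim there is $\varepsilon=\varepsilon(p,d,\mathcal A,L,\Omega')>0$ with property (P), the constant $C$ there depending only on $p,d,\mathcal A,L,\Omega'$ and $\operatorname{dist}(\Omega',\partial\Omega)$. A measure that is absolutely continuous on $\Omega'$ with density in $L^p$ is identified there with its density (''as maps''); convergence in measure and a.e. convergence in (iii) are for these densities on $\Omega'$ with respect to Lebesgue measure. *)

(* Defs.v *)
From HB Require Import structures.
From mathcomp Require Import all_boot all_order all_algebra.
From mathcomp Require Import all_classical all_reals all_analysis.
From mathcomp Require Import measurable_realfun sesquilinear.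
Set Implicit Arguments.
Unset Strict Implicit.
Unset Printing Implicit Defensive.
Import Order.TTheory GRing.Theory Num.Theory.
Import numFieldNormedType.Exports.
Local Open Scope classical_set_scope.
Local Open Scope ring_scope.

(* Matrices over a [realType] carry the Borel sigma-algebra of their topology. *)
Definition mx_borel_display : measure_display.
Proof. exact: default_measure_display. Qed.

Section mx_borel.
Context {R : realType} {m n : nat}.
Let borel : set (set 'M[R]_(m, n)) := <<s open >>.
Let borel0 : borel set0. Proof. exact: sigma_algebra0. Qed.
Let borelC A : borel A -> borel (~` A). Proof. exact: sigma_algebraC. Qed.
Let borelU (F : _^nat) : (forall i, borel (F i)) -> borel (\bigcup_i F i).
Proof. exact: sigma_algebra_bigcup. Qed.
HB.instance Definition _ := @isMeasurable.Build mx_borel_display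
  'M[R]_(m, n) borel borel0 borelC borelU.
End mx_borel.

Lemma mx_open_measurable (R : realType) m n (A : set 'M[R]_(m, n)) :
  open A -> measurable A.
Proof. by move=> oA; exact: sub_sigma_algebra. Qed.

Section cons_rv.
Context {R : realType} {n : nat}.
Definition cons_rv (x : measurableTypeR R * 'rV[R]_n) : 'rV[R]_(1 + n) :=
  row_mx (x.1)%:M x.2.

Lemma cons_rv_ball (q : 'rV[R]_(1 + n)) (e : R) : 0 < e ->
  cons_rv @^-1` (ball q e) =
  (ball (lsubmx q 0 0) e : set R) `*` (ball (rsubmx q) e).
Proof.
move=> e0; apply/seteqP; split => -[x y] /=.
  move=> [_ h]; split => /=.
    by have := h 0 (lshift n 0); rewrite /cons_rv/= row_mxEl !mxE.
  split=> // i j; have := h i (rshift 1 j); rewrite /cons_rv/= row_mxEr.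
  by rewrite mxE (ord1 i).
move=> [/= bx [_ by_]]; split => // i j; rewrite /cons_rv/= mxE (ord1 i).
case: splitP => [j0|j0] jj.
  have -> : j = lshift n j0 by exact/val_inj.
  by move: bx; rewrite !mxE (ord1 j0) mulr1n.
have := by_ 0 j0; rewrite mxE.
by rewrite (_ : j = rshift 1 j0)//; exact/val_inj.
Qed.

Lemma measurable_cons_rv : measurable_fun setT cons_rv.
Proof.
apply: (@measurability _ _ _ _ _ _ (@open 'rV[R]_(1+n))) => //.
move=> _ [A oA <-]; rewrite setTI.
pose c (k : 'rV[rat]_(1 + n) * nat) : set 'rV[R]_(1 + n) :=
  ball (map_mx ratr k.1 : 'rV[R]_(1 + n)) (k.2.+1%:R^-1).
have -> : A = \bigcup_(k in [set k | c k `<=` A]) c k.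
  apply/seteqP; split; last by move=> x [k /= kA /kA].
  move=> x Ax.
  have [e /= e0 eA] : exists2 e : R, 0 < e & ball x e `<=` A.
    have : nbhs x A by exact: open_nbhs_nbhs.
    by move=> /nbhs_ballP[e e0 eA]; exists e.
  pose N := (Num.trunc (2 / e)).+1.
  have N0 : 0 < N.+1%:R^-1 :> R by rewrite invr_gt0.
  have Ne : N.+1%:R^-1 < e / 2 :> R.
    rewrite -[ltRHS]invrK ltf_pV2 ?posrE ?invr_gt0 ?divr_gt0// invf_div.
    apply: (@lt_trans _ _ N%:R); last by rewrite ltr_nat.
    by rewrite /N Num.Theory.truncnS_gt.
  have [q Hq] : exists q : 'rV[rat]_(1 + n), forall j,
      `|x 0 j - ratr (q 0 j)| < N.+1%:R^-1.
    have H j : {q : rat | `|x 0 j - ratr q| < N.+1%:R^-1}.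
      apply: cid.
      have /rat_in_itvoo[q] : x 0 j - N.+1%:R^-1 < x 0 j + N.+1%:R^-1.
        by rewrite ltrBlDr -addrA ltrDl addr_gt0.
      rewrite in_itv/= => /andP[q1 q2]; exists q.
      by rewrite distrC ltr_distl q1.
    by exists (\row_j sval (H j)) => j; rewrite mxE; case: (H j).
  exists (q, N) => /=.
    move=> y [_ yq]; apply: eA; split => // i j.
    rewrite (ord1 i) /ball/=.
    have := yq 0 j; rewrite mxE /ball/= => yj.
    rewrite (_ : x 0 j - y 0 j =
      (x 0 j - ratr (q 0 j)) + (ratr (q 0 j) - y 0 j)); last first.
      by rewrite addrA subrK.
    apply: (le_lt_trans (ler_normD _ _)).
    rewrite [e]splitr ltrD//; first exact: lt_trans Ne.
    exact: lt_trans Ne.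
  split => // i j; rewrite (ord1 i) mxE /ball/= distrC.
  exact: Hq.
rewrite bigcup_mkcond preimage_bigcup.
apply: countable_bigcupT_measurable; first exact: countableP.
move=> k; case: ifPn => _; last by rewrite preimage_set0.
 rewrite /c cons_rv_ball//.
apply: measurableX.
  by apply: open_measurable; exact: ball_open.
by apply: mx_open_measurable; exact: ball_open.
Qed.

Lemma measurable_lsub : measurable_fun [set: 'rV[R]_(1 + n)]
  (fun v : 'rV[R]_(1 + n) => lsubmx v 0 0).
Proof.
apply: (measurability _ (RGenOpens.measurableE R)) => _ [A [a [b ->]] <-].
rewrite setTI; apply: mx_open_measurable.
rewrite openE => v /= Av.
have : nbhs (lsubmx v 0 0) `]a, b[%classic.
  by apply: open_nbhs_nbhs; split => //; exact: interval_open.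
move=> /nbhs_ballP[e /= e0 eA]; apply/nbhs_ballP; exists e => //= w [_ vw].
by apply: eA; rewrite !mxE; exact: vw.
Qed.

Lemma measurable_rsub : measurable_fun [set: 'rV[R]_(1 + n)]
  (fun v : 'rV[R]_(1 + n) => rsubmx v : 'rV[R]_n).
Proof.
apply: (@measurability _ _ _ _ _ _ (@open 'rV[R]_n)) => // _ [A oA <-].
rewrite setTI; apply: mx_open_measurable.
rewrite openE => v /= Av; have : nbhs (rsubmx v) A by exact: open_nbhs_nbhs.
move=> /nbhs_ballP[e /= e0 eA]; apply/nbhs_ballP; exists e => //= w [_ vw].
by apply: eA; split => // i j; rewrite !mxE; exact: vw.
Qed.

End cons_rv.

Section lebesgue_step.
Context {R : realType} {n : nat}.
Variable mu : {sigma_finite_measure set 'rV[R]_n -> \bar R}.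
Local Open Scope ereal_scope.

Definition lebesgue_cons : set 'rV[R]_(1 + n) -> \bar R :=
  pushforward (lebesgue_measure \x mu) cons_rv.

Let m1 : {measure set _ -> \bar R} := lebesgue_measure \x mu.

Let lebesgue_cons_set0 : lebesgue_cons set0 = 0.
Proof. by rewrite /lebesgue_cons/pushforward preimage_set0 measure0. Qed.

Let lebesgue_cons_ge0 A : 0 <= lebesgue_cons A.
Proof. exact: (measure_ge0 m1). Qed.

Let lebesgue_cons_sigma : semi_sigma_additive lebesgue_cons.
Proof.
move=> F mF tF mUF; rewrite /lebesgue_cons /pushforward preimage_bigcup.
have mc (A : set 'rV[R]_(1 + n)) : measurable A -> measurable (cons_rv @^-1` A).
  by move=> mA; rewrite -[X in measurable X]setTI; exact: measurable_cons_rv.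
apply: measure_semi_sigma_additive.
- by move=> i; exact: mc.
- apply/trivIsetP => /= i j _ _ ij; rewrite -preimage_setI.
  by move/trivIsetP : tF => /(_ _ _ _ _ ij) ->//; rewrite preimage_set0.
- by rewrite -preimage_bigcup; exact: mc.
Qed.

HB.instance Definition _ :=
  isMeasure.Build _ _ _ lebesgue_cons lebesgue_cons_set0 lebesgue_cons_ge0 lebesgue_cons_sigma.

Let lebesgue_cons_sigma_finite : sigma_finite setT lebesgue_cons.
Proof.
have /sigma_finiteP[F [TF ndF F_oo]] := sigma_finiteT
  (lebesgue_measure : {sigma_finite_measure set (measurableTypeR R) -> \bar R}).
have /sigma_finiteP[G [TG ndG G_oo]] := sigma_finiteT mu.
pose H k : set 'rV[R]_(1 + n) :=
  (fun v => lsubmx v ord0 ord0) @^-1` F k `&` rsubmx @^-1` G k.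
have HE k : cons_rv @^-1` H k = F k `*` G k.
  rewrite predeqE => -[x y]; rewrite /H /cons_rv /=.
  by rewrite row_mxKl row_mxKr mxE mulr1n.
exists H.
  rewrite predeqE => v; split => // _.
  have [i _ Fi] : (\bigcup_i F i) (lsubmx v ord0 ord0) by rewrite -TF.
  have [j _ Gj] : (\bigcup_j G j) (rsubmx v) by rewrite -TG.
  exists (maxn i j) => //; split.
  - by have /subsetPset := ndF _ _ (leq_maxl i j); exact.
  - by have /subsetPset := ndG _ _ (leq_maxr i j); exact.
move=> k; have [mF Foo] := F_oo k; have [mG Goo] := G_oo k; split.
  apply: measurableI; rewrite -[X in measurable X]setTI.
  - exact: measurable_lsub.
  - exact: measurable_rsub.
rewrite /lebesgue_cons /pushforward HE product_measure1E//.
by rewrite lte_mul_pinfty// ge0_fin_numE.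
Qed.

HB.instance Definition _ :=
  Measure_isSigmaFinite.Build _ _ _ lebesgue_cons lebesgue_cons_sigma_finite.

End lebesgue_step.

(* Lebesgue measure on R^d, as the d-fold product of the one on R; it is
   characterized by [lebesgue_rV_box] below. *)
Fixpoint lebesgue_rV (R : realType) (d : nat) :
    {sigma_finite_measure set 'rV[R]_d -> \bar R} :=
  match d with
  | 0 => \d_(0 : 'rV[R]_0)
  | n.+1 => lebesgue_cons (lebesgue_rV R n)
  end.

Definition rV_box {R : realType} {d : nat} (F : 'I_d -> set R) : set 'rV[R]_d :=
  [set x | forall i, F i (x 0 i)].

Lemma rV_box_cons (R : realType) d (F : 'I_d.+1 -> set R) :
  rV_box F = (fun v : 'rV[R]_(1 + d) => lsubmx v 0 0) @^-1` F ord0 `&`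
          rsubmx @^-1` rV_box (fun i => F (lift ord0 i)).
Proof.
have l0 : lshift d (0 : 'I_1) = ord0 by exact/val_inj.
have r0 i : rshift 1 i = lift ord0 i :> 'I_(1 + d) by exact/val_inj.
rewrite predeqE => v; split => [Fv|[/= F0 Fr] i].
  by split => [|i] /=; rewrite !mxE ?l0 ?r0; exact: Fv.
have [->|] := eqVneq i ord0; first by move: F0; rewrite !mxE l0.
move=> /eqP; case: (unliftP ord0 i) => [j ->|->//] _.
by have := Fr j; rewrite !mxE r0.
Qed.

Lemma measurable_rV_box (R : realType) d (F : 'I_d -> set R) :
  (forall i, measurable (F i)) -> measurable (rV_box F).
Proof.
elim: d F => [|d ih] F mF.
  by rewrite (_ : rV_box F = setT)// predeqE => x; split => // _ [].
rewrite rV_box_cons; apply: measurableI; rewrite -[X in measurable X]setTI.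
- by apply: measurable_lsub => //; exact: mF.
- by apply: measurable_rsub => //; exact: ih.
Qed.

Lemma lebesgue_rV_box (R : realType) d (F : 'I_d -> set R) :
  (forall i, measurable (F i)) ->
  lebesgue_rV R d (rV_box F) = (\prod_(i < d) lebesgue_measure (F i))%E.
Proof.
elim: d F => [|d ih] F mF.
  rewrite big_ord0/= diracE mem_set//= => -[//].
rewrite big_ord_recl -ih// [LHS]/= /lebesgue_cons /pushforward.
rewrite -product_measure1E//; last exact: measurable_rV_box.
  congr (_ _); rewrite rV_box_cons predeqE => -[x y] /=.
  by rewrite /cons_rv /= row_mxKl row_mxKr mxE mulr1n.
exact: mF.
Qed.

Section inner_product_space.
Context {R : realType} {V : vectType R}.
Variable dot : {dot V for idfun}.

Definition dnorm (v : V) : R := Num.sqrt (dot v v).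

Definition dist_to (L : {vspace V}) (v : V) : R :=
  inf [set dnorm (v - l) | l in [set` L]].

Definition convex_cone (K : set V) : Prop :=
  (forall t v, 0 < t -> K v -> K (t *: v)) /\
  (forall t v w, 0 <= t <= 1 -> K v -> K w -> K (t *: v + (1 - t) *: w)).

Definition cone_close (K : set V) (L : {vspace V}) (eps : R) : Prop :=
  forall v, K v -> dot v v = 1 -> dist_to L v <= eps.

End inner_product_space.

Section pde_operator.
Context {R : realType}.

Definition multi_index (d k : nat) :=
  {a : {ffun 'I_d -> 'I_k.+1} | (\sum_(i < d) a i == k)%N}.

Definition pde_op (d k : nat) (V W : vectType R) := multi_index d k -> 'Hom(V, W).

Definition rV_dot {d} (x y : 'rV[R]_d) : R := \sum_(i < d) x 0 i * y 0 i.

Definition enorm {d} (x : 'rV[R]_d) : R := Num.sqrt (rV_dot x x).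

Definition monomial {d k} (a : multi_index d k) (xi : 'rV[R]_d) : R :=
  \prod_(i < d) xi 0 i ^+ val a i.

(* The complexification of W is W * W, the pair (w1, w2) being w1 + i w2. *)
Definition mul_i {W : vectType R} (w : W * W) : W * W := (- w.2, w.1).

Definition principal_symbol {d k} {V W : vectType R} (A : pde_op d k V W)
    (xi : 'rV[R]_d) (v : V) : W * W :=
  (2 * pi) ^+ k *: iter k mul_i (\sum_a monomial a xi *: A a v, 0).

Definition wave_cone {d k} {V W : vectType R} (A : pde_op d k V W) : set V :=
  [set v | exists xi, enorm xi = 1 /\ principal_symbol A xi v = 0].

End pde_operator.

Section domains.
Context {R : realType} {d : nat}.
Implicit Types Om : set 'rV[R]_d.

(* Near every boundary point x0, up to a rotation taking nu to the last basis
   vector, Om is the strict epigraph of a Lipschitz function on the hyperplane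
   orthogonal to nu; the values of gamma outside that hyperplane are unused. *)
Definition lipschitz_boundary Om : Prop :=
  forall x0, (closure Om `\` interior Om) x0 ->
  exists (r M : R) (nu : 'rV[R]_d) (gamma : 'rV[R]_d -> R),
  [/\ 0 < r, enorm nu = 1,
      forall y z, rV_dot y nu = 0 -> rV_dot z nu = 0 ->
        `|gamma y - gamma z| <= M * enorm (y - z) &
      forall x, enorm (x - x0) < r ->
        (Om x <-> gamma (x - rV_dot x nu *: nu) < rV_dot x nu)].

Definition lipschitz_domain Om : Prop :=
  [/\ open Om, bounded_set Om, connected Om & lipschitz_boundary Om].

Definition compactly_contained Om' Om : Prop :=
  compact (closure Om') /\ closure Om' `<=` Om.

End domains.

Section test_functions.
Context {R : realType} {d : nat}.
Implicit Types (f : 'rV[R]_d -> R) (Om : set 'rV[R]_d).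

Definition partial (i : 'I_d) f : 'rV[R]_d -> R :=
  fun x => 'D_(delta_mx 0 i) f x.

Definition smooth f : Prop := forall s : seq 'I_d,
  continuous (foldr partial f s) /\
  forall i x, derivable (foldr partial f s) x (delta_mx 0 i).

Definition multi_partial {k} (a : multi_index d k) f : 'rV[R]_d -> R :=
  foldr (fun i g => iter (val a i) (partial i) g) f (enum 'I_d).

Definition test_fun Om f : Prop :=
  smooth f /\
  exists2 K, compact K /\ K `<=` Om & forall x, ~ K x -> f x = 0.

(* C_0(Om), each function being extended by 0 outside Om. *)
Definition C0_fun Om f : Prop :=
  [/\ continuous f, forall x, ~ Om x -> f x = 0 &
      forall e, 0 < e -> compact [set x | e <= `|f x|]].

End test_functions.

Section vector_measures.
Context {R : realType} {d : nat} {V : vectType R}.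
Variable dot : {dot V for idfun}.
Implicit Types (Om D : set 'rV[R]_d) (f : 'rV[R]_d -> V).
Implicit Types m : set 'rV[R]_d -> \bar R.

(* M(Om; V): finite V-valued Borel measures on Om, extended by 0 to R^d; finite
   Borel measures on open subsets of R^d are automatically Radon. The values on
   non-measurable sets are meaningless and never used. *)
Record vmeasure Om := VMeasure {
  vmeasure_fun :> set 'rV[R]_d -> V ;
  vmeasure_sigma_additive : forall F : nat -> set 'rV[R]_d,
    (forall i, measurable (F i)) -> trivIset setT F ->
    dnorm dot (vmeasure_fun (\bigcup_i F i) - \sum_(i < n) vmeasure_fun (F i))
      @[n --> \oo] --> (0 : R) ;
  vmeasure_out : forall A, measurable A -> A `&` Om = set0 ->
    vmeasure_fun A = 0 }.

Definition variation_measure (mu : set 'rV[R]_d -> V) (A : set 'rV[R]_d) : \bar R :=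
  ereal_sup [set x | exists F : nat -> set 'rV[R]_d,
    [/\ forall i, measurable (F i), trivIset setT F, \bigcup_i F i = A &
        x = (\sum_(0 <= i <oo) (dnorm dot (mu (F i)))%:E)%E]].

Definition vmeasurable D f : Prop :=
  forall w, measurable_fun D (fun x => dot (f x) w).

(* The V-valued integral, computed coordinatewise in a basis of V. *)
Definition vintegral m D f : V :=
  let b := vbasis {:V} in
  \sum_(i < \dim {:V}) fine (\int[m]_(x in D) (coord b i (f x))%:E) *: b`_i.

Definition is_density (mu : set 'rV[R]_d -> V) m D f : Prop :=
  [/\ vmeasurable D f, (\int[m]_(x in D) (dnorm dot (f x))%:E < +oo)%E &
      forall A, measurable A -> A `<=` D -> mu A = vintegral m A f].

Definition polar Om (mu : vmeasure Om) : 'rV[R]_d -> V :=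
  xget (fun=> 0) [set g | is_density mu (variation_measure mu) Om g].

Definition polar_in Om (mu : vmeasure Om) (K : set V) : Prop :=
  {ae variation_measure mu, forall x, Om x -> K (polar mu x)}.

(* The integral of phi with respect to mu, that is of phi dmu/d|mu| against |mu|. *)
Definition integral_against Om (phi : 'rV[R]_d -> R) (mu : vmeasure Om) : V :=
  vintegral (variation_measure mu) Om (fun x => phi x *: polar mu x).

Definition weak_star_cvg Om (mu_ : nat -> vmeasure Om) (mu : vmeasure Om) : Prop :=
  forall phi, C0_fun Om phi ->
    dnorm dot (integral_against phi (mu_ j) - integral_against phi mu)
      @[j --> \oo] --> (0 : R).

Definition Lp_norm D (p : \bar R) f : \bar R :=
  ('N[lebesgue_rV R d]_p[(fun x => (dnorm dot (f x))%:E) \_ D])%E.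

Definition in_Lp D (p : \bar R) f : Prop :=
  vmeasurable D f /\ (Lp_norm D p f < +oo)%E.

Definition has_density D (mu : set 'rV[R]_d -> V) f : Prop :=
  is_density mu (lebesgue_rV R d) D f.

Definition weak_Lp_cvg D (q : R) (u_ : nat -> 'rV[R]_d -> V) (u : 'rV[R]_d -> V)
    : Prop :=
  forall g, in_Lp D (hoelder_conjugate q%:E) g ->
    (\int[lebesgue_rV R d]_(x in D) dot (u_ j x) (g x)) @[j --> \oo] -->
    (\int[lebesgue_rV R d]_(x in D) dot (u x) (g x)).

Definition strong_Lp_cvg D (q : R) (u_ : nat -> 'rV[R]_d -> V) (u : 'rV[R]_d -> V)
    : Prop :=
  Lp_norm D q%:E (fun x => u_ j x - u x) @[j --> \oo] --> 0%E.

Definition cvg_in_measure D (u_ : nat -> 'rV[R]_d -> V) (u : 'rV[R]_d -> V) : Prop :=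
  forall e : R, 0 < e ->
    lebesgue_rV R d [set x | D x /\ e < dnorm dot (u_ j x - u x)]
      @[j --> \oo] --> 0%E.

Definition cvg_ae D (u_ : nat -> 'rV[R]_d -> V) (u : 'rV[R]_d -> V) : Prop :=
  {ae lebesgue_rV R d, forall x, D x ->
    dnorm dot (u_ j x - u x) @[j --> \oo] --> (0 : R)}.

End vector_measures.

Definition equiintegrable {R : realType} {d : nat} (D : set 'rV[R]_d)
    (f : nat -> 'rV[R]_d -> R) : Prop :=
  (exists M : R, forall j,
    (\int[lebesgue_rV R d]_(x in D) `|f j x|%:E <= M%:E)%E) /\
  (forall e : R, 0 < e -> exists2 del : R, 0 < del &
    forall j A, measurable A -> A `<=` D -> (lebesgue_rV R d A < del%:E)%E ->
      (\int[lebesgue_rV R d]_(x in A) `|f j x|%:E < e%:E)%E).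

Section pde_constraint.
Context {R : realType} {d k : nat} {V W : vectType R}.
Variables (dotV : {dot V for idfun}) (dotW : {dot W for idfun}).
Variable A : pde_op d k V W.

(* A mu = sigma in D'(Om; W), a W-valued distribution being a linear map from
   scalar test functions to W. *)
Definition pde_eq Om (mu : vmeasure dotV Om) (sigma : vmeasure dotW Om) : Prop :=
  forall phi, test_fun Om phi ->
    (-1) ^+ k *: \sum_a A a (integral_against (multi_partial a phi) mu) =
    integral_against phi sigma.

Definition higher_integrability (L : {vspace V}) (p : R) (Om Om' : set 'rV[R]_d)
    (eps : R) : Prop :=
  exists C : R, forall (mu : vmeasure dotV Om) (sigma : vmeasure dotW Om) (K : set V),
    pde_eq mu sigma -> convex_cone K -> cone_close dotV K L eps ->
    polar_in mu K ->
    exists u, [/\ has_density dotV Om' mu u, in_Lp dotV Om' p%:E u &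
      (Lp_norm dotV Om' p%:E u <=
        C%:E * (variation_measure dotV mu Om + variation_measure dotW sigma Om))%E].

End pde_constraint.

(* Main.v *)
Require Import Defs.
From HB Require Import structures.
From mathcomp Require Import all_boot all_order all_algebra.
From mathcomp Require Import all_classical all_reals all_analysis.
From mathcomp Require Import sesquilinear measurable_realfun ess_sup_inf.
From mathcomp Require Import ring lra.
Set Implicit Arguments.
Unset Strict Implicit.
Unset Printing Implicit Defensive.
Import Order.TTheory GRing.Theory Num.Theory.
Import numFieldNormedType.Exports.
Local Open Scope classical_set_scope.
Local Open Scope ring_scope.

(** The hypothesis on [eps] bounds the densities [u_j] of the measures [mu_j] in
    [L^p(Om')], uniformly in [j]; everything else follows from this bound, the
    finite measure of [Om'] and [q < p].

    Equiintegrability and strong convergence come from the pointwise inequality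
    [a^q <= t^q + t^(q - p) a^p], whose last factor is small for large [t]
    ([integral_powR_interp]). If [u_j] tends to [u] in measure, the bound passes
    to [u] ([Lp_bound_in_measure]), and [|u_j - u|^q] is small except on a set of
    small measure, where the inequality controls it ([Lq_cvg_in_measure]).

    For the weak convergence the point is that weak-star convergence, together
    with the [L^p] bound, improves to setwise convergence: [mu_j(A)] tends to
    [mu(A)] for every Borel set [A] in [Om'] ([weak_star_setwise]). Indeed the
    indicator of [A] is close to a continuous function [phi] vanishing off [Om'],
    in [L^1] of the sum of the Lebesgue measure and [|mu|]
    ([continuous_approximation]); replacing it by [phi] changes [mu_j(A)] little,
    uniformly in [j] by equiintegrability, and the integrals of [phi] converge.
    Setwise convergence shows at once that [mu] vanishes on Lebesgue null sets of
    [Om'], so that it has a density [u] there. It then extends from indicators to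
    bounded functions by uniform approximation ([setwise_cvg_bounded]). Testing
    with truncations of [u |u|^(p - 2)] bounds [u] in [L^p]
    ([weak_limit_Lp_bound]), and truncating the test functions gives weak
    convergence in [L^p] ([weak_cvg_Lp]), which implies weak convergence in [L^q]
    on a set of finite measure.

    The integral against a vector measure is defined through its polar, so all
    this needs the total variation to be a finite measure and the polar to be a
    density ([polar_density]). These are obtained from the Hahn decompositions of
    the coordinates in a basis of [V] and from the Radon-Nikodym theorem. Scalar
    arguments are applied to the coordinates, which are inner products with the
    vectors of the dual basis ([coord_dot]). *)

(** * Euclidean norms and coordinates *)

Section inner_product.
Context {R : realType} {V : vectType R}.
Variable dot : {dot V for idfun}.
Implicit Types u v w : V.

Local Notation dnorm := (dnorm dot).
Local Notation c i := (coord (vbasis {:V}) i).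

Lemma dotC u v : dot u v = dot v u.
Proof. by rewrite hermC expr0 mul1r. Qed.

Lemma dot_ge0 v : 0 <= dot v v.
Proof.
have [->|v0] := eqVneq v 0; first by rewrite linear0l.
exact/ltW/neq0_dnorm_gt0.
Qed.

Lemma dot_eq0 v : dot v v = 0 -> v = 0.
Proof. by apply: contra_eq => /(neq0_dnorm_gt0 (s:=dot)); rewrite lt0r => /andP[]. Qed.

Lemma dnorm_nneg v : 0 <= dnorm v. Proof. exact: sqrtr_ge0. Qed.

Lemma sqr_dnorm v : dnorm v ^+ 2 = dot v v.
Proof. by rewrite sqr_sqrtr// dot_ge0. Qed.

Lemma dnorm0 : dnorm 0 = 0. Proof. by rewrite /dnorm linear0l sqrtr0. Qed.

Lemma dnorm0_eq0 v : dnorm v = 0 -> v = 0.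
Proof. by move=> v0; apply: dot_eq0; rewrite -sqr_dnorm v0 expr0n. Qed.

Lemma dotZl t u v : dot (t *: u) v = t * dot u v.
Proof. by rewrite linearZl_LR. Qed.

Lemma dotZr t u v : dot u (t *: v) = t * dot u v.
Proof. by rewrite dotC dotZl dotC. Qed.

Lemma dot_suml (I : finType) (x : I -> R) (F : I -> V) w :
  dot (\sum_i x i *: F i) w = \sum_i x i * dot (F i) w.
Proof. by rewrite linear_sumlz; apply: eq_bigr => i _; exact: dotZl. Qed.

Lemma dotDD t u v : dot (t *: u + v) (t *: u + v) =
  t ^+ 2 * dot u u + 2 * t * dot u v + dot v v.
Proof.
rewrite linearDl !linearDr/= !dotZl !dotZr (dotC v u).
by ring.
Qed.

(** The nonnegative quadratic [t |-> |t u + v|^2] is evaluated at its minimum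
    [t = - (u . v) / |u|^2]. *)
Lemma cauchy_schwarz u v : `|dot u v| <= dnorm u * dnorm v.
Proof.
have [->|u0] := eqVneq u 0; first by rewrite linear0l normr0 mulr_ge0// dnorm_nneg.
have uu : 0 < dot u u by exact: neq0_dnorm_gt0.
rewrite -(@ler_pXn2r _ 2)// ?nnegrE ?mulr_ge0 ?dnorm_nneg//.
rewrite exprMn !sqr_dnorm real_normK ?num_real//.
have := dot_ge0 (- (dot u v / dot u u) *: u + v); rewrite dotDD.
have -> : (- (dot u v / dot u u)) ^+ 2 * dot u u +
  2 * - (dot u v / dot u u) * dot u v + dot v v =
  (dot u u * dot v v - dot u v ^+ 2) / dot u u.
  by field; rewrite gt_eqF.
by rewrite pmulr_lge0 ?invr_gt0// subr_ge0.
Qed.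

Lemma ler_dnormD u v : dnorm (u + v) <= dnorm u + dnorm v.
Proof.
rewrite -(@ler_pXn2r _ 2)// ?nnegrE ?addr_ge0 ?dnorm_nneg//.
rewrite sqr_dnorm -[u in leLHS]scale1r dotDD sqrrD !sqr_dnorm.
have := le_trans (ler_norm _) (cauchy_schwarz u v).
by rewrite mulr2n; lra.
Qed.

Lemma dnorm_scale t v : dnorm (t *: v) = `|t| * dnorm v.
Proof.
rewrite /dnorm dotZl dotZr mulrA sqrtrM; last by rewrite -expr2 sqr_ge0.
by rewrite -expr2 sqrtr_sqr.
Qed.

Lemma dnorm_opp v : dnorm (- v) = dnorm v.
Proof. by rewrite -scaleN1r dnorm_scale normrN1 mul1r. Qed.

Lemma dnorm_sum (I : Type) (s : seq I) (F : I -> V) :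
  dnorm (\sum_(i <- s) F i) <= \sum_(i <- s) dnorm (F i).
Proof.
elim/big_ind2 : _ => //; first by rewrite dnorm0.
by move=> u r v t ur vt; exact: le_trans (ler_dnormD _ _) (lerD ur vt).
Qed.

(** The coordinates are represented by the vectors of the dual basis, which the
    inverse of the (positive definite) Gram matrix gives. *)
Lemma coord_dot (i : 'I_(\dim {:V})) : exists w, forall v, c i v = dot v w.
Proof.
pose n := \dim {:V}; pose b := vbasis {:V}.
pose G : 'M[R]_n := \matrix_(j, k) dot b`_j b`_k.
have Gu : G \in unitmx.
  rewrite -row_free_unit; apply: inj_row_free => x xG.
  pose v := \sum_j x 0 j *: b`_j.
  have v0 : v = 0.
    apply: dot_eq0; rewrite {2}/v linear_sumr/= big1// => k _.
    rewrite dotZr /v dot_suml.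
    have /(congr1 (fun A : 'rV_n => A 0 k)) := xG; rewrite !mxE => xk.
    transitivity (x 0 k * \sum_j x 0 j * G j k); last by rewrite xk mulr0.
    by congr (_ * _); apply: eq_bigr => j _; rewrite mxE.
  apply/rowP => k; rewrite mxE.
  have /(congr1 (coord b k)) := v0.
  rewrite linear0 coord_sum_free//; exact: (basis_free (vbasisP _)).
exists (\sum_k invmx G k i *: b`_k) => v.
rewrite {2}(coord_vbasis (memvf v)) dot_suml/=.
transitivity (\sum_j c j v * (1%:M : 'M[R]_n) j i).
  rewrite (bigD1 i)//= mxE eqxx mulr1 big1 ?addr0// => j ji.
  by rewrite mxE (negbTE ji) mulr0.
apply: eq_bigr => j _; congr (_ * _).
rewrite -(mulmxV Gu) mxE linear_sumr/=; apply: eq_bigr => k _.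
by rewrite dotZr mxE mulrC.
Qed.

Lemma coord_bound : exists2 C : R, 0 < C & forall i v, `|c i v| <= C * dnorm v.
Proof.
have /choice[w wP] := coord_dot.
exists (1 + \sum_i dnorm (w i)).
  by rewrite ltr_wpDr// sumr_ge0// => i _; exact: dnorm_nneg.
move=> i v; rewrite wP mulrC (le_trans (cauchy_schwarz _ _))//.
rewrite ler_wpM2l ?dnorm_nneg// (bigD1 i)//= addrCA lerDl addr_ge0//.
by rewrite sumr_ge0// => j _; exact: dnorm_nneg.
Qed.

Lemma dnorm_coord v :
  dnorm v <= \sum_i `|c i v| * dnorm (vbasis {:V})`_i.
Proof.
rewrite {1}(coord_vbasis (memvf v)); apply: le_trans (dnorm_sum _ _) _.
by apply: ler_sum => i _; rewrite dnorm_scale.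
Qed.

Lemma dot_coord v w : dot v w = \sum_i c i v * dot (vbasis {:V})`_i w.
Proof.
by rewrite {1}(coord_vbasis (memvf v)) dot_suml.
Qed.

Lemma coord_vsum (x : 'I_(\dim {:V}) -> R) i :
  c i (\sum_j x j *: (vbasis {:V})`_j) = x i.
Proof. by rewrite coord_sum_free//; exact: (basis_free (vbasisP _)). Qed.

Lemma eq_coord u v : (forall i, c i u = c i v) -> u = v.
Proof.
move=> uv; rewrite (coord_vbasis (memvf u)) (coord_vbasis (memvf v)).
by apply: eq_bigr => i _; rewrite uv.
Qed.

End inner_product.

Section vmeasurable.
Context {R : realType} {d : nat} {V : vectType R}.
Variable dot : {dot V for idfun}.
Variable D : set 'rV[R]_d.
Hypothesis mD : measurable D.
Implicit Types f g : 'rV[R]_d -> V.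

Local Notation dnorm := (dnorm dot).
Local Notation c i := (coord (vbasis {:V}) i).

Lemma vmeasurableP f : vmeasurable dot D f <->
  forall i, measurable_fun D (fun x => c i (f x)).
Proof.
split=> [mf i|mf w].
  have [w cw] := coord_dot dot i.
  by apply: eq_measurable_fun (mf w) => x _; rewrite cw.
apply: (@eq_measurable_fun _ _ _ _ _
  (fun x => \sum_i c i (f x) * dot (vbasis {:V})`_i w)).
  by move=> x _; rewrite -dot_coord.
apply: measurable_sum => i; apply: measurable_funM => //.
Qed.

Lemma measurable_dot f g : vmeasurable dot D f -> vmeasurable dot D g ->
  measurable_fun D (fun x => dot (f x) (g x)).
Proof.
move=> /vmeasurableP mf mg; apply: (@eq_measurable_fun _ _ _ _ _
  (fun x => \sum_i c i (f x) * dot (vbasis {:V})`_i (g x))).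
  by move=> x _; rewrite -dot_coord.
apply: measurable_sum => i; apply: measurable_funM => //.
by apply: eq_measurable_fun (mg (vbasis {:V})`_i) => x _; rewrite dotC.
Qed.

Lemma measurable_dnorm f : vmeasurable dot D f ->
  measurable_fun D (fun x => dnorm (f x)).
Proof.
move=> mf; have ms : measurable_fun [set: R] (@Num.sqrt R).
  by apply: continuous_measurable_fun; exact: sqrt_continuous.
exact: (measurableT_comp ms (measurable_dot mf mf)).
Qed.

Lemma vmeasurableB f g : vmeasurable dot D f -> vmeasurable dot D g ->
  vmeasurable dot D (fun x => f x - g x).
Proof.
move=> mf mg w; apply: (@eq_measurable_fun _ _ _ _ _
  (fun x => dot (f x) w - dot (g x) w)).
  by move=> x _; rewrite linearBl.
exact: measurable_funB.
Qed.

End vmeasurable.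

(** * Setwise convergence of measures with densities *)

Lemma ler_dist3 (R : realFieldType) (a b c z e : R) :
  `|a - b| <= e / 3 -> `|b - c| <= e / 3 -> `|c - z| <= e / 3 -> `|a - z| <= e.
Proof.
move=> h1 h2 h3; rewrite (_ : a - z = (a - b) + (b - c) + (c - z)); last by ring.
rewrite (le_trans (ler_normD _ _))//.
have := ler_normD (a - b) (b - c); lra.
Qed.

Section integrable_helpers.
Context d (T : measurableType d) (R : realType).
Variables (m : {measure set T -> \bar R}) (D : set T).
Hypothesis mD : measurable D.
Implicit Types f g : T -> R.

Lemma integrable_le f g : measurable_fun D f -> m.-integrable D (EFin \o g) ->
  (forall x, D x -> `|f x| <= g x) -> m.-integrable D (EFin \o f).
Proof.
move=> mf ig fg; apply: le_integrable ig => //; first exact/measurable_EFinP.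
by move=> x Dx; rewrite lee_fin (le_trans (fg _ Dx))// ler_norm.
Qed.

Lemma integrable_measurable f : m.-integrable D (EFin \o f) -> measurable_fun D f.
Proof. by move=> /measurable_int /measurable_EFinP. Qed.

Lemma EFin_Rintegral f : m.-integrable D (EFin \o f) ->
  (\int[m]_(x in D) f x)%:E = (\int[m]_(x in D) (f x)%:E)%E.
Proof. by move=> fi; rewrite /Rintegral fineK//; exact: integrable_fin_num. Qed.

Lemma integrable_mul_bounded f g M : m.-integrable D (EFin \o f) ->
  measurable_fun D g -> (forall x, D x -> `|g x| <= M) ->
  m.-integrable D (EFin \o (fun x => f x * g x)).
Proof.
move=> fi mg gM; have mf := integrable_measurable fi.
apply: (@integrable_le _ (fun x => M * `|f x|)).
- exact: measurable_funM.
- have /(integrableZl mD M) := integrable_norm fi.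
  by apply: eq_integrable => // x _.
- by move=> x Dx; rewrite normrM mulrC ler_wpM2r// gM.
Qed.

Lemma integrable_cst (c : R) : (m D < +oo)%E -> m.-integrable D (EFin \o cst c).
Proof.
move=> Doo; apply: measurable_bounded_integrable => //.
by exists `|c|; split; [exact: num_real|move=> M cM x _ /=; exact: ltW].
Qed.

End integrable_helpers.

Section setwise_convergence.
Context d (T : measurableType d) (R : realType).
Variables (m_ : nat -> {measure set T -> \bar R}) (m : {measure set T -> \bar R}).
Variables (D : set T) (f_ : nat -> T -> R) (f : T -> R) (B : R).
Hypothesis mD : measurable D.
Hypothesis fi_ : forall j, (m_ j).-integrable D (EFin \o f_ j).
Hypothesis fi : m.-integrable D (EFin \o f).
Hypothesis fB_ : forall j, \int[m_ j]_(x in D) `|f_ j x| <= B.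
Hypothesis cvg_set : forall A, measurable A -> A `<=` D ->
  \int[m_ j]_(x in A) f_ j x @[j --> \oo] --> \int[m]_(x in A) f x.

Let tested (g : T -> R) := [/\ measurable_fun D g, exists M : R, forall x, D x -> `|g x| <= M &
  \int[m_ j]_(x in D) (f_ j x * g x) @[j --> \oo] -->
  \int[m]_(x in D) (f x * g x)].

Let tested0 : tested (cst 0).
Proof.
split=> //; first by exists 0 => x _; rewrite normr0.
have E (n : {measure set T -> \bar R}) h : \int[n]_(x in D) (h x * cst 0 x) = 0.
  under eq_Rintegral do rewrite mulr0.
  by rewrite Rintegral_cst// mul0r.
by rewrite E; under eq_fun do rewrite E; exact: cvg_cst.
Qed.

Let tested_add g A c : tested g -> measurable A -> A `<=` D ->
  tested (fun x => g x + c * \1_A x).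
Proof.
move=> [mg [M gM] cg] mA AD; have mI : measurable_fun D (\1_A : T -> R) by [].
have IM x : D x -> `|\1_A x| <= 1 :> R.
  by move=> _; rewrite ger0_norm ?indicE//; case: (_ \in _).
split.
- by apply: measurable_funD => //; exact: measurable_funM.
- exists (M + `|c|) => x Dx; rewrite (le_trans (ler_normD _ _))// lerD ?gM//.
  by rewrite normrM ler_piMr// IM.
- have E (n : {measure set T -> \bar R}) h : n.-integrable D (EFin \o h) ->
    \int[n]_(x in D) (h x * (g x + c * \1_A x)) =
    \int[n]_(x in D) (h x * g x) + c * \int[n]_(x in A) h x.
    move=> hi; have i1 := integrable_mul_bounded mD hi mg gM.
    have i2 := integrable_mul_bounded mD hi mI IM.
    have i3 : n.-integrable D (EFin \o (fun x => c * (h x * \1_A x))).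
      by have := integrableZl mD c i2; apply: eq_integrable.
    rewrite -[A in \int[n]_(x in A) h x](setIidr AD) Rintegral_mkcondr.
    rewrite -RintegralZl//; last first.
      apply: eq_integrable i2 => // x _ /=.
      by rewrite patchE indicE; case: ifPn => _; rewrite ?mulr1 ?mulr0.
    transitivity (\int[n]_(x in D) (h x * g x + c * (h x * \1_A x))).
      by apply: eq_Rintegral => x _; ring.
    rewrite RintegralD//; congr (_ + _); apply: eq_Rintegral => x _.
    by rewrite patchE indicE; case: ifPn => _; rewrite ?mulr1 ?mulr0.
  rewrite E//; under eq_fun do rewrite E//.
  apply: cvgD => //; apply: cvgM; [exact: cvg_cst|exact: cvg_set].
Qed.

Let tested_lim (g : T -> R) : measurable_fun D g ->
  (forall e : R, 0 < e -> exists2 s, tested s & forall x, D x -> `|g x - s x| <= e) ->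
  tested g.
Proof.
move=> mg gs; have [s1 [_ [M1 s1M] _] gs1] := gs 1 ltr01.
have gM x : D x -> `|g x| <= 1 + M1.
  move=> Dx; rewrite -[g x](subrK (s1 x)) (le_trans (ler_normD _ _))//.
  by rewrite lerD ?gs1 ?s1M.
split=> //; first by exists (1 + M1).
pose C := B + \int[m]_(x in D) `|f x| + 1.
have B0 : 0 <= B by rewrite (le_trans _ (fB_ 0))// Rintegral_ge0.
have F0 : 0 <= \int[m]_(x in D) `|f x| by exact: Rintegral_ge0.
have C0 : 0 < C by rewrite /C; lra.
apply/cvgrPdist_le => e e0.
have [|s [ms [M sM] cs] gse] := gs (e / 2 / C); first by rewrite !divr_gt0.
have E (n : {measure set T -> \bar R}) h : n.-integrable D (EFin \o h) ->
  `|\int[n]_(x in D) (h x * g x) - \int[n]_(x in D) (h x * s x)| <=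
    e / 2 / C * \int[n]_(x in D) `|h x|.
  move=> hi; have i1 := integrable_mul_bounded mD hi mg gM.
  have i2 := integrable_mul_bounded mD hi ms sM.
  have i4 := integrableB mD i1 i2.
  rewrite -RintegralB// (le_trans (le_normr_Rintegral _ _))// -RintegralZl//.
    apply: le_Rintegral => //.
    - exact: (integrable_norm i4).
    - have := integrableZl mD (e / 2 / C) (integrable_norm hi).
      by apply: eq_integrable.
    - move=> x Dx; rewrite -mulrBr normrM mulrC ler_wpM2r// gse//.
  exact: integrable_norm.
have e20 : 0 < e / 2 by rewrite divr_gt0.
move/cvgrPdist_le : cs => /(_ _ e20); apply: filterS => j csj.
have := E _ _ fi; have := E _ _ (fi_ j); rewrite distrC => E1 E2.
have K1 : e / 2 / C * \int[m_ j]_(x in D) `|f_ j x| <= e / 2 / C * B.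
  by rewrite ler_wpM2l// !divr_ge0 ?ltW.
have K2 : e / 2 / C * B + e / 2 / C * \int[m]_(x in D) `|f x| <= e / 2.
  rewrite -mulrDr mulrAC ler_pdivrMr// ler_wpM2l ?(ltW e20)//.
  by rewrite /C lerDl.
move: (\int[m]_(x in D) (f x * g x)) (\int[m]_(x in D) (f x * s x))
  (\int[m_ j]_(x in D) (f_ j x * s x)) (\int[m_ j]_(x in D) (f_ j x * g x))
  csj E1 E2 => a b c z csj E1 E2.
rewrite (_ : a - z = (a - b) + (b - c) + (c - z)); last by ring.
rewrite (le_trans (ler_normD _ _))//.
have := ler_normD (a - b) (b - c); lra.
Qed.

(** Peeling off [e] times the indicator of [{g >= e}] lowers the upper bound
    [n * e] of [g] by [e]; once it is below [e], the zero function will do. *)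
Let tested_approx (e : R) n (g : T -> R) : 0 < e -> measurable_fun D g ->
  (forall x, D x -> 0 <= g x <= e *+ n.+1) ->
  exists2 s, tested s & forall x, D x -> `|g x - s x| <= e.
Proof.
move=> e0; elim: n g => [|n ih] g mg gn.
  exists (cst 0); first exact: tested0.
  by move=> x /gn/andP[g0 ge]; rewrite subr0 ger0_norm.
pose A := D `&` [set x | e <= g x].
have mA : measurable A by apply: measurable_fun_le.
pose g' x := g x - e * \1_A x.
have mg' : measurable_fun D g'.
  by apply: measurable_funB => //; exact: measurable_funM.
have [x Dx|s gs gse] := ih g' mg'.
  have /andP[g0 gn1] := gn _ Dx; rewrite /g' indicE.
  have [|] := boolP (x \in A).
    rewrite inE => -[_ /= eg]; rewrite mulr1 subr_ge0 eg/=.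
    by rewrite lerBlDr -mulrSr.
  move=> xA; rewrite mulr0 subr0 g0/=; apply: (@le_trans _ _ e).
    by apply/ltW; rewrite ltNge; apply: contra xA => eg; rewrite inE.
  by rewrite mulrS lerDl mulrn_wge0// ltW.
exists (fun x => s x + e * \1_A x); first by apply: tested_add => // x [].
move=> x Dx; rewrite (_ : _ - _ = g' x - s x); first exact: gse.
by rewrite /g'; ring.
Qed.

(** Setwise convergence of the measures [f_ j dm_ j], of bounded mass, extends
    from indicators to bounded functions by uniform approximation; letting the
    reference measures vary also gives, on constant sequences, that two
    densities of one set function have the same integrals. *)
Lemma setwise_cvg_bounded (g : T -> R) (M : R) : measurable_fun D g ->
  (forall x, D x -> `|g x| <= M) ->
  \int[m_ j]_(x in D) (f_ j x * g x) @[j --> \oo] -->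
  \int[m]_(x in D) (f x * g x).
Proof.
move=> mg gM; suff [] : tested g by [].
apply: tested_lim => // e e0.
pose h x := g x + `|M|; have mh : measurable_fun D h by exact: measurable_funD.
have [n nM] : exists n, (`|M| + `|M|) / e <= n%:R.
  exists (Num.truncn ((`|M| + `|M|) / e)).+1; exact/ltW/Num.Theory.truncnS_gt.
have [x Dx|s gs hse] := @tested_approx e n h e0 mh.
  have := gM _ Dx; rewrite /h ler_norml => /andP[g1 g2].
  have MM := ler_norm M; apply/andP; split; first by lra.
  apply: (@le_trans _ _ (`|M| + `|M|)); first by rewrite lerD2r; lra.
  move: nM; rewrite ler_pdivrMr// => /le_trans; apply.
  by rewrite mulrC mulr_natr ler_wpMn2l// ltW.
exists (fun x => s x + (- `|M|) * \1_D x); first exact: tested_add.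
move=> x Dx; rewrite indicE mem_set// mulr1.
by have := hse _ Dx; rewrite /h; congr (`|_| <= _); ring.
Qed.

End setwise_convergence.

(** * Integrals of powers *)

Section powR_inequalities.
Context {R : realType}.
Implicit Types a b t p q : R.

(** The first term bounds the left-hand side when [a <= t]; otherwise [a^q] is
    [a^(q - p) * a^p] and the exponent [q - p] is negative. *)
Lemma powR_interp a t p q : 0 <= a -> 0 < t -> 0 <= q -> q <= p ->
  a `^ q <= t `^ q + t `^ (q - p) * a `^ p.
Proof.
move=> a0 t0 q0 qp; have [at_|ta] := leP a t.
  by rewrite ler_wpDr ?mulr_ge0 ?powR_ge0// ge0_ler_powR// nnegrE ltW.
have a_gt0 : 0 < a by exact: lt_trans ta.
have -> : a `^ q = a `^ (q - p) * a `^ p.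
  by rewrite -powRD ?subrK//; apply/implyP => _; exact: lt0r_neq0.
rewrite ler_wpDl ?powR_ge0// ler_wpM2r ?powR_ge0//.
rewrite -[q - p]opprB !powRN lef_pV2 ?posrE ?powR_gt0//.
by rewrite ge0_ler_powR ?subr_ge0// ?nnegrE ltW.
Qed.

Lemma powRD_le a b p : 0 <= a -> 0 <= b -> 0 <= p ->
  (a + b) `^ p <= 2 `^ p * (a `^ p + b `^ p).
Proof.
move=> a0 b0 p0; wlog ab : a b a0 b0 / a <= b => [wl|].
  by have [/wl|/ltW /wl] := leP a b; [exact|rewrite addrC [a `^ _ + _]addrC; exact].
apply: (@le_trans _ _ ((2 * b) `^ p)).
  by rewrite ge0_ler_powR// ?nnegrE ?addr_ge0 ?mulr_ge0//; lra.
by rewrite powRM// ler_wpM2l ?powR_ge0// lerDr powR_ge0.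
Qed.

Lemma powR_root r b : r != 0 -> 0 <= b -> (b `^ r^-1) `^ r = b.
Proof. by move=> r0 b0; rewrite -powRrM mulVf// powRr1. Qed.

(** Young's inequality for [t a] and [b / t]: the parameter makes one term small
    at the expense of the other. *)
Lemma young_param a b t p p' : 0 <= a -> 0 <= b -> 0 < t ->
  1 <= p -> 1 <= p' -> p^-1 + p'^-1 = 1 ->
  a * b <= t `^ p * a `^ p + (t^-1) `^ p' * b `^ p'.
Proof.
move=> a0 b0 t0 p1 p'1 pp'; have p0 : 0 < p by lra.
have p'0 : 0 < p' by lra.
have := @conjugate_powR _ (t * a) (t^-1 * b) p p'.
rewrite !mulr_ge0 ?invr_ge0 ?(ltW t0)// => /(_ isT isT p0 p'0 pp').
rewrite mulrACA divff ?gt_eqF// mul1r => /le_trans; apply.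
rewrite !powRM ?invr_ge0 ?(ltW t0)// lerD// ler_piMr ?mulr_ge0 ?powR_ge0//.
- by rewrite invf_le1.
- by rewrite invf_le1.
Qed.

End powR_inequalities.

Section ereal_cvg0.
Context {R : realType}.
Implicit Types u : nat -> \bar R.

Lemma ge0_cvge0 u : (forall j, 0 <= u j)%E ->
  (forall e : R, 0 < e -> \forall j \near \oo, (u j <= e%:E)%E) ->
  u j @[j --> \oo] --> 0%E.
Proof.
move=> u0 ue; apply/fine_cvgP; split.
  have := ue 1 ltr01; apply: filterS => j uj.
  by rewrite ge0_fin_numE// (le_lt_trans uj)// ltry.
apply/cvgrPdist_le => e /ue; apply: filterS => j uj /=.
rewrite sub0r normrN ger0_norm ?fine_ge0//.
by rewrite -lee_fin fineK// ge0_fin_numE// (le_lt_trans uj)// ltry.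
Qed.

Lemma cvge0_le u : u j @[j --> \oo] --> 0%E ->
  forall e : R, 0 < e -> \forall j \near \oo, (u j <= e%:E)%E.
Proof.
move=> /fine_cvgP[ufin /cvgrPdist_le uc] e /uc.
apply: filterS2 ufin => j uj; rewrite sub0r normrN => ue.
by rewrite -(fineK uj) lee_fin (le_trans (ler_norm _) ue).
Qed.

End ereal_cvg0.

Section Lp_functions.
Context d (T : measurableType d) (R : realType).
Variables (m : {measure set T -> \bar R}) (D : set T).
Hypothesis mD : measurable D.
Hypothesis Doo : (m D < +oo)%E.
Implicit Types f g w : T -> R.

Lemma measurable_set_lt f g : measurable_fun D f -> measurable_fun D g ->
  measurable (D `&` [set x | f x < g x]).
Proof.
move=> mf mg; rewrite (_ : _ `&` _ = D `\` (D `&` [set x | g x <= f x])).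
  by apply: measurableD => //; exact: measurable_fun_le.
apply/seteqP; split => x /=.
  by move=> [Dx fg]; split=> // -[_]; rewrite leNgt fg.
by move=> [Dx fg]; split=> //; rewrite ltNge; apply/negP => gf; exact: fg.
Qed.

Lemma measurable_fun_powR f p : measurable_fun D f ->
  measurable_fun D (fun x => f x `^ p).
Proof. by move=> mf; exact: (measurableT_comp (measurable_powR _)). Qed.

Lemma measurable_fun_norm_powR f p : measurable_fun D f ->
  measurable_fun D (fun x => `|f x| `^ p).
Proof.
move=> mf; apply: measurable_fun_powR; exact: (measurableT_comp _ mf).
Qed.

Lemma integrable_norm_powR f p : measurable_fun D f ->
  (\int[m]_(x in D) (`|f x| `^ p)%:E < +oo)%E ->
  m.-integrable D (EFin \o (fun x => `|f x| `^ p)).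
Proof.
move=> mf foo; apply/integrableP; split.
  by apply/measurable_EFinP; exact: measurable_fun_norm_powR.
apply: le_lt_trans foo; rewrite le_eqVlt; apply/orP; left; apply/eqP.
by apply: eq_integral => x _ /=; rewrite ger0_norm ?powR_ge0.
Qed.

Lemma ge0_measure_fin : m D = (fine (m D))%:E.
Proof. by rewrite fineK// ge0_fin_numE. Qed.

Lemma ge0_integral_EFin_le f g : measurable_fun D f -> measurable_fun D g ->
  (forall x, D x -> 0 <= f x <= g x) ->
  (\int[m]_(x in D) (f x)%:E <= \int[m]_(x in D) (g x)%:E)%E.
Proof.
move=> mf mg fg; apply: ge0_le_integral => //.
- by move=> x /fg/andP[]; rewrite lee_fin.
- exact/measurable_EFinP.
- exact/measurable_EFinP.
- by move=> x /fg/andP[]; rewrite lee_fin.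
Qed.

Lemma ge0_integral_EFinD f g : measurable_fun D f -> measurable_fun D g ->
  (forall x, D x -> 0 <= f x) -> (forall x, D x -> 0 <= g x) ->
  (\int[m]_(x in D) (f x + g x)%:E =
   \int[m]_(x in D) (f x)%:E + \int[m]_(x in D) (g x)%:E)%E.
Proof.
move=> mf mg f0 g0; under eq_integral do rewrite EFinD.
rewrite ge0_integralD//.
- exact/measurable_EFinP.
- exact/measurable_EFinP.
Qed.

Lemma ge0_integral_EFinZ f c : measurable_fun D f -> 0 <= c ->
  (forall x, D x -> 0 <= f x) ->
  (\int[m]_(x in D) (c * f x)%:E = c%:E * \int[m]_(x in D) (f x)%:E)%E.
Proof.
move=> mf c0 f0; under eq_integral do rewrite EFinM.
rewrite ge0_integralZl_EFin//.
exact/measurable_EFinP.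
Qed.

Lemma integral_EFin_cst c :
  (\int[m]_(x in D) c%:E = c%:E * m D)%E.
Proof. by rewrite -integral_cst. Qed.

(** As [t] grows the factor of [B] tends to [0] when [q < p]: this is how a bound
    in [L^p] gives equiintegrability in [L^q]. *)
Lemma integral_powR_interp w t p q (B : \bar R) : measurable_fun D w ->
  (forall x, D x -> 0 <= w x) -> 0 < t -> 0 <= q -> q <= p ->
  (\int[m]_(x in D) (w x `^ p)%:E <= B)%E ->
  (\int[m]_(x in D) (w x `^ q)%:E <= (t `^ q)%:E * m D + (t `^ (q - p))%:E * B)%E.
Proof.
move=> mw w0 t0 q0 qp wB.
have mp := measurable_fun_powR p mw; have mq := measurable_fun_powR q mw.
have mtp : measurable_fun D (fun x => t `^ (q - p) * w x `^ p).
  exact: measurable_funM.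
apply: (@le_trans _ _ (\int[m]_(x in D) (t `^ q + t `^ (q - p) * w x `^ p)%:E)%E).
  apply: ge0_integral_EFin_le => //; first exact: measurable_funD.
  by move=> x Dx; rewrite powR_ge0 powR_interp// w0.
rewrite ge0_integral_EFinD//.
- rewrite integral_EFin_cst leeD2l// ge0_integral_EFinZ ?powR_ge0//.
  + by rewrite lee_pmul2l ?lte_fin ?powR_gt0.
  + by move=> x _; exact: powR_ge0.
- by move=> x _; exact: powR_ge0.
- by move=> x _; rewrite mulr_ge0 ?powR_ge0.
Qed.

Lemma Lp_sub w p q : measurable_fun D w ->
  (forall x, D x -> 0 <= w x) -> 0 <= q -> q <= p ->
  (\int[m]_(x in D) (w x `^ p)%:E < +oo)%E ->
  (\int[m]_(x in D) (w x `^ q)%:E < +oo)%E.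
Proof.
move=> mw w0 q0 qp wp.
rewrite (le_lt_trans (integral_powR_interp mw w0 ltr01 q0 qp (lexx _)))//.
by rewrite !powR1 !mul1e lte_add_pinfty.
Qed.

(** Where [w_ j <= e] the integrand is at most [e `^ q]; the rest is a set of
    small measure, on which the bound in [L^p] controls the integral. *)
Lemma Lq_cvg_in_measure (w_ : nat -> T -> R) (p q B : R) :
  (forall j, measurable_fun D (w_ j)) ->
  (forall j x, D x -> 0 <= w_ j x) ->
  0 < q -> q < p ->
  (forall j, (\int[m]_(x in D) (w_ j x `^ p)%:E <= B%:E)%E) ->
  (forall e : R, 0 < e -> m (D `&` [set x | e < w_ j x]) @[j --> \oo] --> 0%E) ->
  (\int[m]_(x in D) (w_ j x `^ q)%:E)%E @[j --> \oo] --> 0%E.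
Proof.
move=> mw w0 q0 qp wB wm.
have Bge0 : 0 <= B.
  by rewrite -lee_fin (le_trans _ (wB 0))// integral_ge0// => x _; rewrite lee_fin powR_ge0.
have key (e t : R) j : 0 < e -> 0 < t ->
  ((\int[m]_(x in D) (w_ j x `^ q)%:E) <= (e `^ q)%:E * m D +
    ((t `^ q)%:E * m (D `&` [set x | (e < w_ j x)%R]) + (t `^ (q - p) * B)%:E))%E.
  move=> e0 t0; set E := D `&` _.
  have mE : measurable E by exact: measurable_set_lt.
  have mI : measurable_fun D (fun x => t `^ q * \1_E x).
    by apply: measurable_funM.
  have I0 x : 0 <= t `^ q * \1_E x by rewrite mulr_ge0 ?powR_ge0// indicE.
  have mp : measurable_fun D (fun x => t `^ (q - p) * w_ j x `^ p).
    by apply: measurable_funM => //; exact: measurable_fun_powR.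
  have p0 x : 0 <= t `^ (q - p) * w_ j x `^ p by rewrite mulr_ge0 ?powR_ge0.
  have mIp := measurable_funD mI mp.
  apply: (@le_trans _ _ (\int[m]_(x in D) (e `^ q +
      (t `^ q * \1_E x + t `^ (q - p) * w_ j x `^ p))%:E)%E).
    apply: ge0_integral_EFin_le.
    - exact: measurable_fun_powR.
    - exact: measurable_funD.
    - move=> x Dx; rewrite powR_ge0/=; have [ew|we] := ltP e (w_ j x).
        rewrite indicE mem_set// mulr1 ler_wpDl ?powR_ge0// powR_interp ?w0 ?ltW//.
      by rewrite ler_wpDr ?addr_ge0// ge0_ler_powR ?nnegrE ?w0// ltW.
  rewrite ge0_integral_EFinD//; [|by move=> x _; exact: powR_ge0|by move=> x _; exact: addr_ge0].
  rewrite integral_EFin_cst leeD2l// ge0_integral_EFinD// leeD//.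
    rewrite ge0_integral_EFinZ ?powR_ge0//.
    by rewrite integral_indic// setIidl//; move=> x [].
  rewrite ge0_integral_EFinZ ?powR_ge0//; last 2 first.
  - exact: measurable_fun_powR.
  - by move=> x _; exact: powR_ge0.
  by rewrite EFinM lee_wpmul2l// lee_fin powR_ge0.
apply: ge0_cvge0 => [j|eps eps0].
  by rewrite integral_ge0// => x _; rewrite lee_fin powR_ge0.
have M0 : 0 <= fine (m D) by rewrite fine_ge0.
(* [e] and [t] solve [e `^ q = de] and [t `^ (q - p) = dt]: the first and the last
   term of the estimate are then at most [eps / 3]. *)
pose de := eps / 3 / (fine (m D) + 1); pose dt := eps / 3 / (B + 1).
have de0 : 0 < de by rewrite !divr_gt0//; lra.
have dt0 : 0 < dt by rewrite !divr_gt0//; lra.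
pose e := de `^ q^-1; pose t := dt `^ (q - p)^-1.
have e0 : 0 < e by rewrite powR_gt0.
have t0 : 0 < t by rewrite powR_gt0.
have tq0 : 0 < t `^ q by rewrite powR_gt0.
have eps30 : 0 < eps / 3 / t `^ q by rewrite !divr_gt0.
have := cvge0_le (wm e e0) eps30; apply: filterS => j Ej.
apply: le_trans (key e t j e0 t0) _.
rewrite (_ : eps = eps / 3 + (eps / 3 + eps / 3)); last by field.
rewrite 2!EFinD leeD//; last rewrite leeD//.
- rewrite ge0_measure_fin -EFinM lee_fin powR_root ?gt_eqF ?(ltW de0)//.
  by rewrite /de mulrAC ler_pdivrMr ?ler_wpM2l//; lra.
- rewrite (@le_trans _ _ ((t `^ q)%:E * (eps / 3 / t `^ q)%:E)%E)//.
    by rewrite lee_wpmul2l// lee_fin ltW.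
  by rewrite -EFinM lee_fin mulrCA divff ?gt_eqF// mulr1.
- rewrite lee_fin powR_root ?(ltW dt0)//; last by rewrite lt_eqF// subr_lt0.
  by rewrite /dt mulrAC ler_pdivrMr ?ler_wpM2l//; lra.
Qed.

(** Dominated convergence of the indicators of the sets; [D] has finite measure. *)
Lemma ae_cvg_in_measure (w_ : nat -> T -> R) :
  (forall j, measurable_fun D (w_ j)) -> (forall j x, D x -> 0 <= w_ j x) ->
  {ae m, forall x, D x -> w_ j x @[j --> \oo] --> 0} ->
  forall e : R, 0 < e -> m (D `&` [set x | e < w_ j x]) @[j --> \oo] --> 0%E.
Proof.
move=> mw w0 wae e e0; pose E j := D `&` [set x | e < w_ j x].
have mE j : measurable (E j) by exact: measurable_set_lt.
have [] := @dominated_convergence _ _ _ m D mD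
  (fun j x => (\1_(E j) x)%:E) (cst 0%E) (cst 1%E).
- by move=> j; apply/measurable_EFinP.
- by [].
- apply: filterS wae => x wx Dx.
  apply: cvg_near_cst; have /cvgrPdist_lt/(_ e e0) := wx Dx.
  apply: filterS => j; rewrite sub0r normrN ger0_norm ?w0// => we.
  rewrite indicE memNset// => -[_ /= ew].
  by have := lt_trans we ew; rewrite ltxx.
- exact: integrable_cst.
- apply: aeW => x j Dx; rewrite gee0_abs// lee_fin indicE; by case: (_ \in _).
move=> _ _; rewrite integral0; apply: cvg_trans; apply: near_eq_cvg.
by apply: nearW => j; rewrite /= integral_indic// setIidl// => x [].
Qed.

Lemma integral_le_exhaustion w f (C : \bar R) :
  measurable_fun D w -> measurable_fun D f -> (forall x, D x -> 0 <= f x) ->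
  (forall n : nat,
    (\int[m]_(x in D `&` [set x | (w x <= n%:R)%R]) (f x)%:E <= C)%E) ->
  (\int[m]_(x in D) (f x)%:E <= C)%E.
Proof.
move=> mw mf f0 fC; pose F n := D `&` [set x | w x <= n%:R].
have mF n : measurable (F n) by exact: measurable_fun_le.
have FD : \bigcup_n F n = D.
  apply/seteqP; split=> [x [n _ []]//|x Dx].
  exists (Num.truncn (w x)).+1 => //; split=> //=.
  exact/ltW/Num.Theory.truncnS_gt.
have := @ge0_nondecreasing_set_cvg_integral _ _ _ F (EFin \o f) m.
rewrite FD => /(_ _ mF).
have ndF : nondecreasing_seq F.
  apply/nondecreasing_seqP => n; rewrite subsetEset => x [Dx /= wn]; split=> //=.
  by rewrite (le_trans wn)// ler_nat.
have mfF n : measurable_fun (F n) (EFin \o f).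
  by apply/measurable_EFinP; apply: measurable_funS mf => // x [].
have F0 n x : F n x -> (0 <= (EFin \o f) x)%E by move=> [/f0]; rewrite lee_fin.
move=> /(_ ndF mfF F0) /cvg_lim <-//; apply: lime_le; last exact: nearW.
apply: ereal_nondecreasing_is_cvgn.
exact: ge0_nondecreasing_set_nondecreasing_integral.
Qed.

(** The bound passes to the limit in measure: off the set [{v_ j > 1}], whose
    measure tends to [0], the limit is at most [w_ j + 1]. *)
Lemma Lp_bound_in_measure (w : T -> R) (w_ v_ : nat -> T -> R) (p B : R) :
  measurable_fun D w -> (forall j, measurable_fun D (w_ j)) ->
  (forall j, measurable_fun D (v_ j)) ->
  (forall x, D x -> 0 <= w x) -> (forall j x, D x -> 0 <= w_ j x) ->
  (forall j x, D x -> w x <= w_ j x + v_ j x) -> 0 < p ->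
  (forall j, (\int[m]_(x in D) (w_ j x `^ p)%:E <= B%:E)%E) ->
  (forall e : R, 0 < e -> m (D `&` [set x | e < v_ j x]) @[j --> \oo] --> 0%E) ->
  (\int[m]_(x in D) (w x `^ p)%:E <= (2 `^ p)%:E * (B%:E + m D))%E.
Proof.
move=> mw mw_ mv_ w0 w_0 wv p0 wB vm.
have mp := measurable_fun_powR p mw.
apply: (integral_le_exhaustion mw mp) => [x _|n]; first exact: powR_ge0.
set F := D `&` _; have mF : measurable F by exact: measurable_fun_le.
apply/lee_addgt0Pr => e e0.
(* [j] is chosen after [n], so the factor [n^p] is harmless. *)
have e'0 : 0 < e / (n%:R `^ p + 1) by rewrite divr_gt0// ltr_wpDl ?powR_ge0.
have [j _ /(_ j (leqnn _)) vj] := cvge0_le (vm 1 ltr01) e'0.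
set E := D `&` _ in vj.
have mE : measurable E by exact: measurable_set_lt.
have mwp : measurable_fun D (fun x => w_ j x `^ p) by exact: measurable_fun_powR.
have m1 : measurable_fun D (fun x => w_ j x `^ p + 1) by exact: measurable_funD.
have m2 : measurable_fun D (fun x => 2 `^ p * (w_ j x `^ p + 1)).
  exact: measurable_funM.
have m3 : measurable_fun D (fun x => n%:R `^ p * \1_E x) by exact: measurable_funM.
have p2 x : 0 <= 2 `^ p * (w_ j x `^ p + 1) by rewrite mulr_ge0 ?addr_ge0 ?powR_ge0.
have p3 x : 0 <= n%:R `^ p * \1_E x by rewrite mulr_ge0 ?powR_ge0.
pose h x := 2 `^ p * (w_ j x `^ p + 1) + n%:R `^ p * \1_E x.
have mh : measurable_fun D h by exact: measurable_funD.
have h0 x : 0 <= h x by exact: addr_ge0.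
have FD' : F `<=` D by move=> x [].
apply: (@le_trans _ _ (\int[m]_(x in D) (h x)%:E)%E).
  apply: (@le_trans _ _ (\int[m]_(x in F) (h x)%:E)%E); last first.
    apply: ge0_subset_integral => //; first exact/measurable_EFinP.
    by move=> x _; rewrite lee_fin.
  apply: ge0_le_integral => //.
  - by move=> x _; rewrite lee_fin powR_ge0.
  - by apply/measurable_EFinP; apply: measurable_funS mp.
  - by apply/measurable_EFinP; exact: measurable_funS mh.
  - move=> x [Dx /= wn]; rewrite lee_fin /h indicE.
    have [|] := boolP (x \in E).
      rewrite inE mulr1 => _; rewrite ler_wpDl ?mulr_ge0 ?addr_ge0 ?powR_ge0//.
      by rewrite ge0_ler_powR ?(ltW p0)// nnegrE ?ler0n ?w0.
    move=> xE; rewrite mulr0 addr0.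
    have v1 : v_ j x <= 1.
      by rewrite leNgt; apply: contra xE => v1; rewrite inE.
    rewrite (@le_trans _ _ ((w_ j x + 1) `^ p))//.
      rewrite ge0_ler_powR ?(ltW p0)// ?nnegrE ?addr_ge0 ?w_0 ?w0//.
      by rewrite (le_trans (wv j x Dx))// lerD2l.
    by rewrite (le_trans (powRD_le _ _ _))// ?w_0 ?(ltW p0)// powR1.
rewrite ge0_integral_EFinD// leeD//.
  rewrite ge0_integral_EFinZ ?powR_ge0//; last by move=> x _; rewrite addr_ge0 ?powR_ge0.
  rewrite lee_wpmul2l ?lee_fin ?powR_ge0// ge0_integral_EFinD//; last first.
    by move=> x _; exact: powR_ge0.
  by rewrite leeD// integral_EFin_cst mul1e.
rewrite ge0_integral_EFinZ ?powR_ge0// integral_indic// setIidl; last by move=> x [].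
rewrite (le_trans (lee_wpmul2l _ vj)) ?lee_fin ?powR_ge0//.
rewrite mulrA ler_pdivrMr; last by rewrite ltr_wpDl ?powR_ge0.
by rewrite mulrC ler_wpM2l ?(ltW e0)// lerDl.
Qed.

Lemma integral_tail_cvg0 w f : measurable_fun D w ->
  m.-integrable D (EFin \o f) -> (forall x, D x -> 0 <= f x) ->
  (\int[m]_(x in D) (f x * \1_(D `&` [set x | (n%:R < w x)%R]) x)%:E)%E
    @[n --> \oo] --> 0%E.
Proof.
move=> mw fi f0; have mf := integrable_measurable fi.
have mE (n : nat) : measurable (D `&` [set x | n%:R < w x]) by exact: measurable_set_lt.
have [] := @dominated_convergence _ _ _ m D mD
  (fun n x => (f x * \1_(D `&` [set x | n%:R < w x]) x)%:E) (cst 0%E) (EFin \o f).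
- by move=> n; apply/measurable_EFinP; exact: measurable_funM.
- by [].
- apply: aeW => x Dx; apply: cvg_near_cst.
  have : \forall n \near \oo, w x <= n%:R.
    exists (Num.truncn (w x)).+1 => // n /= gn.
    by rewrite ltW// (lt_le_trans (Num.Theory.truncnS_gt _))// ler_nat.
  apply: filterS => n gn; rewrite indicE memNset ?mulr0//= => -[_].
  by rewrite ltNge gn.
- by [].
- apply: aeW => x n Dx; rewrite gee0_abs lee_fin ?mulr_ge0 ?f0//.
  by rewrite ler_piMr ?f0// indicE; case: (_ \in _).
by move=> _ _; rewrite integral0.
Qed.

End Lp_functions.

(** * Weak limits of bounded sequences in Lp *)

Section weak_limits.
Context d (T : measurableType d) (R : realType).
Variables (m : {measure set T -> \bar R}) (D : set T) (p p' B : R).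
Variables (f_ : nat -> T -> R) (f : T -> R).
Hypothesis mD : measurable D.
Hypothesis Doo : (m D < +oo)%E.
Hypothesis p1 : 1 < p.
Hypothesis p'1 : 1 <= p'.
Hypothesis pp' : p^-1 + p'^-1 = 1.
Hypothesis fi_ : forall j, m.-integrable D (EFin \o f_ j).
Hypothesis fi : m.-integrable D (EFin \o f).
Hypothesis fB_ : forall j, (\int[m]_(x in D) (`|f_ j x| `^ p)%:E <= B%:E)%E.
Hypothesis cvg_set : forall A, measurable A -> A `<=` D ->
  \int[m]_(x in A) f_ j x @[j --> \oo] --> \int[m]_(x in A) f x.

Let p0 : 0 < p. Proof. by rewrite (lt_trans _ p1). Qed.
Let p'0 : 0 < p'. Proof. by rewrite (lt_le_trans _ p'1). Qed.

Let mf_ j : measurable_fun D (f_ j). Proof. exact: (integrable_measurable (fi_ j)). Qed.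
Let mf : measurable_fun D f. Proof. exact: (integrable_measurable fi). Qed.

Let fpi_ j : m.-integrable D (EFin \o (fun x => `|f_ j x| `^ p)).
Proof.
apply: integrable_norm_powR => //; exact: le_lt_trans (fB_ j) (ltry _).
Qed.

Let fL1_ : exists C, forall j, \int[m]_(x in D) `|f_ j x| <= C.
Proof.
exists (fine (m D) + B) => j; rewrite -lee_fin EFin_Rintegral//; last first.
  exact: integrable_norm.
rewrite (eq_integral (fun x => (`|f_ j x| `^ 1)%:E)); last first.
  by move=> x _; rewrite powRr1.
have := @integral_powR_interp _ _ _ m D mD (fun x => `|f_ j x|) 1 p 1 B%:E
  (measurableT_comp _ (mf_ j)).
rewrite !powR1 !mul1e EFinD -ge0_measure_fin//; apply => //; exact: ltW.
Qed.

Let cvg_bounded (g : T -> R) (M : R) : measurable_fun D g ->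
  (forall x, D x -> `|g x| <= M) ->
  \int[m]_(x in D) (f_ j x * g x) @[j --> \oo] --> \int[m]_(x in D) (f x * g x).
Proof.
move=> mg gM; have [C fC] := fL1_.
exact: (@setwise_cvg_bounded _ _ _ (fun=> m) m D f_ f C) mg gM.
Qed.

(** Testing against the truncations [g] of [f |f|^(p-2)], for which
    [f g = |f|^p = |g|^p'] where [|f| <= n], Young's inequality gives
    [int f g <= B / p + (int f g) / p'], that is [int f g <= B]. *)
Lemma weak_limit_Lp_bound : (\int[m]_(x in D) (`|f x| `^ p)%:E <= B%:E)%E.
Proof.
apply: (@integral_le_exhaustion _ _ _ m D mD (fun x => `|f x|)) => //.
- exact: measurableT_comp.
- exact: measurable_fun_norm_powR.
move=> n; set F := D `&` _.
have mnf : measurable_fun D (fun x => `|f x|) by exact: measurableT_comp.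
have mF : measurable F by exact: measurable_fun_le.
pose g x := f x * `|f x| `^ (p - 1 - 1) * \1_F x.
have mg : measurable_fun D g.
  by apply: measurable_funM => //; apply: measurable_funM => //; exact: measurable_fun_norm_powR.
have ng x : `|g x| = `|f x| `^ (p - 1) * \1_F x.
  rewrite /g !normrM (ger0_norm (powR_ge0 _ _)) mulr_powRB1 ?subr_gt0//.
  by rewrite [X in _ * X]ger0_norm.
have gM x : D x -> `|g x| <= n%:R `^ (p - 1).
  move=> Dx; rewrite ng indicE; have [|_] := boolP (x \in F); last first.
    by rewrite mulr0 powR_ge0.
  rewrite inE => -[_ /= fn]; rewrite mulr1 ge0_ler_powR ?nnegrE ?ler0n//.
  by rewrite subr_ge0 ltW.
have fg x : f x * g x = `|f x| `^ p * \1_F x.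
  rewrite /g mulrA; congr (_ * _); rewrite -(@mulr_powRB1 _ _ p)//.
  rewrite -(@mulr_powRB1 _ _ (p - 1)) ?subr_gt0// !mulrA; congr (_ * _).
  by rewrite -normrM ger0_norm// -expr2 sqr_ge0.
have gp' x : `|g x| `^ p' = f x * g x.
  rewrite fg ng indicE; have [|_] := boolP (x \in F); last first.
    by rewrite !mulr0 powR0// gt_eqF.
  rewrite !mulr1 -powRrM => _; congr (_ `^ _).
  have h : p * p' = p + p'.
    by rewrite -[LHS]mul1r -pp'; field; rewrite !gt_eqF.
  by rewrite mulrBl mul1r h addrK.
have fgi := integrable_mul_bounded mD fi mg gM.
have fgi_ j := integrable_mul_bounded mD (fi_ j) mg gM.
have XE : (\int[m]_(x in F) (`|f x| `^ p)%:E)%E = (\int[m]_(x in D) (f x * g x))%:E.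
  rewrite EFin_Rintegral// integral_mkcondr; apply: eq_integral => x xD.
  by rewrite fg patchE indicE /F in_setI xD/=; case: ifPn => _; rewrite ?mulr1 ?mulr0.
rewrite XE lee_fin; set X := \int[m]_(x in D) (f x * g x).
have X_le j : \int[m]_(x in D) (f_ j x * g x) <= B / p + X / p'.
  have i1 : m.-integrable D (EFin \o (fun x => p^-1 * `|f_ j x| `^ p)).
    by have := integrableZl mD p^-1 (fpi_ j); apply: eq_integrable.
  have i2 : m.-integrable D (EFin \o (fun x => p'^-1 * (f x * g x))).
    by have := integrableZl mD p'^-1 fgi; apply: eq_integrable.
  apply: (@le_trans _ _ (\int[m]_(x in D)
      (p^-1 * `|f_ j x| `^ p + p'^-1 * (f x * g x)))).
    apply: le_Rintegral => //.
      by have := integrableD mD i1 i2; apply: eq_integrable.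
    move=> x Dx; rewrite (le_trans (ler_norm _))// normrM -gp'.
    by rewrite [p^-1 * _]mulrC [p'^-1 * _]mulrC conjugate_powR.
  rewrite RintegralD// !RintegralZl// lerD//; last by rewrite mulrC.
  rewrite mulrC ler_wpM2r ?invr_ge0 ?(ltW p0)//.
  by rewrite -lee_fin EFin_Rintegral.
have : X <= B / p + X / p'.
  rewrite {1}/X; have /cvg_lim <- // := cvg_bounded mg gM.
  apply: limr_le; last exact: nearW.
  exact: cvgP (cvg_bounded mg gM).
have -> : p'^-1 = 1 - p^-1 by rewrite -pp' addrC addKr.
by rewrite mulrBr mulr1 addrCA lerDl -mulrBl pmulr_lge0 ?invr_gt0// subr_ge0.
Qed.

(** The truncations of [g] are bounded functions; what they leave out is small
    in [L^p'], hence negligible against [L^p]-bounded functions. *)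
Lemma weak_cvg_Lp (g : T -> R) : measurable_fun D g ->
  (\int[m]_(x in D) (`|g x| `^ p')%:E < +oo)%E ->
  \int[m]_(x in D) (f_ j x * g x) @[j --> \oo] --> \int[m]_(x in D) (f x * g x).
Proof.
move=> mg goo.
have mng : measurable_fun D (fun x => `|g x|) by exact: measurableT_comp.
have B0 : 0 <= B.
  by rewrite -lee_fin (le_trans _ (fB_ 0))// integral_ge0// => x _; rewrite lee_fin powR_ge0.
pose E (n : nat) := D `&` [set x | n%:R < `|g x|].
have mE n : measurable (E n) by exact: measurable_set_lt.
pose h n x := g x * \1_(E n) x.
have mh n : measurable_fun D (h n) by exact: measurable_funM.
have hg n x : `|h n x| <= `|g x|.
  by rewrite normrM ler_piMr// indicE; case: (_ \in _); rewrite ?normr1 ?normr0.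
have hcvg : (\int[m]_(x in D) (`|h n x| `^ p')%:E)%E @[n --> \oo] --> 0%E.
  have hE : (fun n => \int[m]_(x in D) (`|h n x| `^ p')%:E)%E = (fun n =>
      \int[m]_(x in D) (`|g x| `^ p' * \1_(E n) x)%:E)%E.
    apply/funext => n; apply: eq_integral => x _; congr EFin.
    rewrite /h indicE; case: (_ \in _); rewrite ?mulr1// !mulr0 normr0 powR0//.
    by rewrite gt_eqF.
  rewrite hE.
  exact: (integral_tail_cvg0 mD mng (integrable_norm_powR mg goo)
    (fun x _ => powR_ge0 `|g x| p')).
pose gn n x := g x * (1 - \1_(E n) x).
have mgn n : measurable_fun D (gn n).
  by apply: measurable_funM => //; exact: measurable_funB.
have gnM n x : D x -> `|gn n x| <= n%:R.
  move=> Dx; rewrite /gn indicE; have [_|] := boolP (x \in E n).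
    by rewrite subrr mulr0 normr0.
  move=> xE; rewrite subr0 mulr1 leNgt; apply: contra xE => gx.
  by rewrite inE.
have bound (k : T -> R) n t : m.-integrable D (EFin \o k) ->
    (\int[m]_(x in D) (`|k x| `^ p)%:E <= B%:E)%E -> 0 < t ->
    (`|\int[m]_(x in D) (k x * g x) - \int[m]_(x in D) (k x * gn n x)|%:E <=
      (t `^ p * B)%:E + (t^-1 `^ p')%:E * \int[m]_(x in D) (`|h n x| `^ p')%:E)%E.
  move=> ki kB t0; have mk := integrable_measurable ki.
  have ps (a r : R) : 0 <= a `^ r by exact: powR_ge0.
  have mkp : measurable_fun D (fun x => t `^ p * `|k x| `^ p).
    by apply: measurable_funM => //; exact: measurable_fun_norm_powR.
  have mhp : measurable_fun D (fun x => t^-1 `^ p' * `|h n x| `^ p').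
    by apply: measurable_funM => //; exact: measurable_fun_norm_powR.
  have mkh : measurable_fun D (fun x => k x * h n x) by exact: measurable_funM.
  have hp_oo : (\int[m]_(x in D) (`|h n x| `^ p')%:E < +oo)%E.
    apply: le_lt_trans goo; apply: ge0_integral_EFin_le => //.
    - exact: measurable_fun_norm_powR.
    - exact: measurable_fun_norm_powR.
    - by move=> x _; rewrite powR_ge0 ge0_ler_powR ?nnegrE ?(ltW p'0).
  have khB : (\int[m]_(x in D) `|k x * h n x|%:E <=
      (t `^ p * B)%:E + (t^-1 `^ p')%:E * \int[m]_(x in D) (`|h n x| `^ p')%:E)%E.
    apply: (@le_trans _ _ (\int[m]_(x in D)
        (t `^ p * `|k x| `^ p + t^-1 `^ p' * `|h n x| `^ p')%:E)%E).
      apply: ge0_integral_EFin_le => //.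
      - exact: measurableT_comp.
      - exact: measurable_funD.
      - by move=> x Dx; rewrite normr_ge0/= normrM young_param ?(ltW p1).
    rewrite ge0_integral_EFinD//.
    - rewrite leeD//.
        rewrite ge0_integral_EFinZ//; first by rewrite EFinM lee_wpmul2l// lee_fin.
        exact: measurable_fun_norm_powR.
      rewrite ge0_integral_EFinZ//.
      exact: measurable_fun_norm_powR.
    - by move=> x _; rewrite mulr_ge0 ?powR_ge0.
    - by move=> x _; rewrite mulr_ge0 ?powR_ge0.
  have khi : m.-integrable D (EFin \o (fun x => k x * h n x)).
    apply/integrableP; split; first exact/measurable_EFinP.
    apply: (le_lt_trans khB).
    by rewrite lte_add_pinfty ?ltry// lte_mul_pinfty ?lee_fin ?powR_ge0.
  have kgi := integrable_mul_bounded mD ki (mgn n) (gnM n).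
  have kgE : \int[m]_(x in D) (k x * g x) =
      \int[m]_(x in D) (k x * gn n x) + \int[m]_(x in D) (k x * h n x).
    rewrite -RintegralD//; apply: eq_Rintegral => x _.
    by rewrite /gn /h -mulrDr -mulrDr subrK mulr1.
  rewrite kgE addrAC subrr add0r; apply: le_trans khB.
  rewrite -EFin_Rintegral//; last exact: (integrable_norm khi).
  by rewrite lee_fin le_normr_Rintegral.
apply/cvgrPdist_le => e e0.
have e6 : 0 < e / 6 by rewrite divr_gt0.
(* With [t `^ p = dt] the first term of [bound] is at most [e / 6]; only then is
   the truncation level [n] chosen. *)
pose dt := e / 6 / (B + 1); have dt0 : 0 < dt by rewrite divr_gt0//; lra.
pose t := dt `^ p^-1; have t0 : 0 < t by rewrite powR_gt0.
have t1 : 0 < t^-1 `^ p' by rewrite powR_gt0// invr_gt0.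
have e6t : 0 < e / 6 / t^-1 `^ p' by rewrite divr_gt0.
have [n _ /(_ n (leqnn n)) hn] := cvge0_le hcvg e6t.
have err (k : T -> R) : m.-integrable D (EFin \o k) ->
    (\int[m]_(x in D) (`|k x| `^ p)%:E <= B%:E)%E ->
    `|\int[m]_(x in D) (k x * g x) - \int[m]_(x in D) (k x * gn n x)| <= e / 3.
  move=> ki kB; rewrite -lee_fin (le_trans (bound k n t ki kB t0))//.
  rewrite (_ : e / 3 = e / 6 + e / 6); last by field.
  rewrite EFinD leeD//.
    rewrite lee_fin powR_root ?gt_eqF ?(ltW dt0)//.
    by rewrite /dt mulrAC ler_pdivrMr ?ler_wpM2l ?(ltW e6)//; lra.
  rewrite (le_trans (lee_wpmul2l _ hn)) ?lee_fin ?powR_ge0//.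
  by rewrite mulrCA divff ?mulr1// gt_eqF.
have e3 : 0 < e / 3 by rewrite divr_gt0.
have /cvgrPdist_le/(_ _ e3) := cvg_bounded (mgn n) (gnM n).
apply: filterS => j jn; apply: (ler_dist3 (err _ fi weak_limit_Lp_bound) jn).
by rewrite distrC; exact: err.
Qed.

End weak_limits.

(** * Approximation of Borel sets by continuous functions *)

Section distance_to_complement.
Context {R : realType} {X : normedModType R}.
Variable U : set X.
Implicit Types x y : X.

(** The distance to the complement of [U], truncated at [1] so that it makes
    sense when [U] is the whole space. *)
Definition codist x : R := inf ([set 1] `|` [set `|x - y| | y in ~` U]).

Let codist_lb x : lbound ([set 1] `|` [set `|x - y| | y in ~` U]) 0.
Proof. by move=> r [->//|[y _ <-]]. Qed.

Let codist_has_lb x : has_lbound ([set 1] `|` [set `|x - y| | y in ~` U]).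
Proof. by exists 0; exact: codist_lb. Qed.

Lemma codist_ge0 x : 0 <= codist x.
Proof. by apply: lb_le_inf; [exists 1; left|exact: codist_lb]. Qed.

Lemma codist_le1 x : codist x <= 1.
Proof. by apply: ge_inf; [exact: codist_has_lb|left]. Qed.

Lemma codist_out x : ~ U x -> codist x = 0.
Proof.
move=> Ux; apply/eqP; rewrite eq_le codist_ge0 andbT.
by apply: ge_inf; [exact: codist_has_lb|right; exists x; rewrite ?subrr ?normr0].
Qed.

Lemma codist_gt0 x : open U -> U x -> 0 < codist x.
Proof.
move=> oU Ux; have /nbhs_ballP[r /= r0 rU] : nbhs x U by exact: open_nbhs_nbhs.
apply: (@lt_le_trans _ _ (Num.min 1 r)); first by rewrite lt_min ltr01.
apply: lb_le_inf; first by exists 1; left.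
move=> _ [->|[y Uy <-]]; rewrite ge_min ?lexx//.
apply/orP; right; rewrite leNgt; apply/negP => xy; apply: Uy; apply: rU.
by rewrite -ball_normE.
Qed.

Lemma codist_lipschitz x y : codist x <= codist y + `|x - y|.
Proof.
rewrite -lerBlDr; apply: lb_le_inf; first by exists 1; left.
move=> _ [->|[z Uz <-]]; rewrite lerBlDr.
  by rewrite (le_trans (codist_le1 _))// lerDl.
apply: (@le_trans _ _ `|x - z|).
  by apply: ge_inf; [exact: codist_has_lb|right; exists z].
by rewrite [leRHS]addrC (le_trans _ (ler_normD _ _))// addrA subrK.
Qed.

Lemma continuous_codist : continuous codist.
Proof.
move=> x; apply/cvgrPdist_le => e e0.
have /nbhs_ballP[r /= r0 re] : nbhs x (ball x e) by exact: nbhsx_ballx.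
apply/nbhs_ballP; exists e => //= y; rewrite -ball_normE /= => xy.
rewrite (le_trans _ (ltW xy))// ler_norml lerBrDl; apply/andP; split.
  by have := codist_lipschitz y x; rewrite distrC; lra.
by have := codist_lipschitz x y; lra.
Qed.

End distance_to_complement.

Section continuous_functions.
Context {R : realType} {X : topologicalType}.
Implicit Types f g : X -> R.

Lemma continuous_compl f : continuous f -> continuous (fun x => 1 - f x).
Proof. by move=> cf x; apply: cvgB; [exact: cvg_cst|exact: cf]. Qed.

Lemma continuous_mul f g : continuous f -> continuous g ->
  continuous (fun x => f x * g x).
Proof. by move=> cf cg x; apply: cvgM; [exact: cf|exact: cg]. Qed.

Lemma continuous_exp f k : continuous f -> continuous (fun x => f x ^+ k).
Proof.
move=> cf; elim: k => [|k ih]; first by move=> x; exact: cvg_cst.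
by under eq_fun do rewrite exprS; exact: continuous_mul.
Qed.

End continuous_functions.

Section continuous_approximation.
Context {R : realType} {n : nat}.
Local Notation E := 'rV[R]_n.
Implicit Types (phi : E -> R) (A U : set E).

Lemma continuous_measurable_rV phi : continuous phi -> measurable_fun [set: E] phi.
Proof.
move=> cphi; apply: (measurability _ (RGenOpens.measurableE R)) => _ [_ [a [b ->]] <-].
rewrite setTI; apply: mx_open_measurable.
by apply: open_comp; [move=> x _; exact: cphi|exact: interval_open].
Qed.

Variables (nu : {measure set E -> \bar R}) (D : set E).
Hypothesis oD : open D.
Hypothesis nuD : (nu D < +oo)%E.

Let mD : measurable D. Proof. exact: mx_open_measurable. Qed.

Let test phi := [/\ continuous phi, forall x, 0 <= phi x <= 1 &
  forall x, ~ D x -> phi x = 0].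

Let err A phi := (\int[nu]_(x in D) `|\1_A x - phi x|%:E)%E.

Let approximable A := measurable A /\
  forall e : R, 0 < e -> exists2 phi, test phi & (err A phi <= e%:E)%E.

Let mphi phi : test phi -> measurable_fun D phi.
Proof. by move=> [c _ _]; apply: measurable_funTS; exact: continuous_measurable_rV. Qed.

Let merr A phi : measurable A -> test phi ->
  measurable_fun D (fun x => `|\1_A x - phi x|).
Proof.
move=> mA tphi; apply: measurableT_comp => //; apply: measurable_funB => //.
exact: mphi.
Qed.

Let errD A B C phi psi chi : measurable A -> measurable B -> measurable C ->
  test phi -> test psi -> test chi ->
  (forall x, D x -> `|\1_C x - chi x| <= `|\1_A x - phi x| + `|\1_B x - psi x|) ->
  (err C chi <= err A phi + err B psi)%E.
Proof.
move=> mA mB mC tp ts tc h.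
rewrite /err -ge0_integral_EFinD//; [|exact: merr..].
apply: ge0_integral_EFin_le => //; [exact: merr| |].
  by apply: measurable_funD; exact: merr.
by move=> x Dx; rewrite normr_ge0 h.
Qed.

Let test0 : test (cst 0).
Proof. by split=> //[|x]; [exact: cst_continuous|rewrite lexx ler01]. Qed.

(* The functions [1 - (1 - delta)^k] of the truncated distance [delta] to the
   complement of [A :&: D] increase to the indicator of that set. *)
Let approximable_open A : open A -> approximable A.
Proof.
move=> oA; split=> [|e e0]; first exact: mx_open_measurable.
pose de := codist (A `&` D); have oAD : open (A `&` D) by exact: openI.
pose phi k x := 1 - (1 - de x) ^+ k.+1.
have d01 x : 0 <= 1 - de x <= 1.
  by rewrite subr_ge0 codist_le1 lerBlDr lerDl codist_ge0.
have tphi k : test (phi k).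
  split.
  - apply: continuous_compl; apply: continuous_exp; apply: continuous_compl.
    exact: continuous_codist.
  - move=> x; have /andP[d0 d1] := d01 x.
    by rewrite subr_ge0 lerBlDr lerDl exprn_ge0// exprn_ile1.
  - by move=> x Dx; rewrite /phi /de codist_out ?subr0 ?expr1n ?subrr// => -[_].
have [] := @dominated_convergence _ _ _ nu D mD
  (fun k x => `|\1_A x - phi k x|%:E)%E (cst 0%E) (cst 1%E).
- by move=> k; apply/measurable_EFinP; apply: merr => //; exact: mx_open_measurable.
- by [].
- apply: aeW => x Dx; apply: cvg_EFin; first exact: nearW.
  have [Ax|Ax] := pselect (A x); last first.
    apply: cvg_near_cst; apply: nearW => k.
    rewrite /= indicE memNset// /phi /de codist_out; last by move=> [].
    by rewrite subr0 expr1n subrr subr0 normr0.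
  rewrite [X in X @ _ --> _](_ : _ = fun k => (1 - de x) ^+ k.+1).
    rewrite (cvg_shiftS (fun k => (1 - de x) ^+ k)); apply: cvg_expr.
    rewrite ger0_norm; last by case/andP: (d01 x).
    by rewrite ltrBlDr ltrDl codist_gt0.
  apply/funext => k /=; rewrite indicE mem_set// /phi opprB addrC subrK.
  by rewrite ger0_norm// exprn_ge0//; case/andP: (d01 x).
- exact: integrable_cst.
- apply: aeW => x k Dx; rewrite gee0_abs// lee_fin.
  have [_ /(_ x) /andP[p0 p1] _] := tphi k.
  rewrite ler_norml indicE; case: (_ \in _) => /=; lra.
move=> _ _; rewrite integral0 => /cvge0_le/(_ _ e0)[k _ /(_ k (leqnn k))] ke.
by exists (phi k) => //; exact: ke.
Qed.

Let approximableC A : approximable A -> approximable (~` A).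
Proof.
move=> [mA Aa]; split=> [|e e0]; first exact: measurableC.
have e20 : 0 < e / 2 by rewrite divr_gt0.
have [phi tphi phie] := Aa _ e20.
have [_ /(_ _ e20)[chi tchi chie]] := approximable_open openT.
exists (fun x => chi x * (1 - phi x)).
  move: tphi tchi => [cp p01 p0] [cc c01 c0]; split.
  - by apply: continuous_mul => //; exact: continuous_compl.
  - move=> x; have /andP[c1 c2] := c01 x; have /andP[p1 p2] := p01 x.
    by rewrite mulr_ge0 ?subr_ge0//= mulr_ile1 ?subr_ge0// lerBlDr lerDl.
  - by move=> x /c0 ->; rewrite mul0r.
have -> : e = e / 2 + e / 2 by field.
apply: le_trans (leeD chie phie); apply: errD => //.
- exact: measurableC.
- case: tphi tchi => [cp p01 p0] [cc c01 c0]; split.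
  + by apply: continuous_mul => //; exact: continuous_compl.
  + move=> x; have /andP[c1 c2] := c01 x; have /andP[p1 p2] := p01 x.
    by rewrite mulr_ge0 ?subr_ge0//= mulr_ile1 ?subr_ge0// lerBlDr lerDl.
  + by move=> x /c0 ->; rewrite mul0r.
move=> x Dx; have [_ /(_ x) /andP[p0 p1] _] := tphi.
rewrite !indicE in_setC in_setT/=.
have -> : (~~ (x \in A))%:R = 1 - (x \in A)%:R :> R.
  by case: (x \in A); rewrite ?subrr ?subr0.
rewrite (_ : _ - _ = (1 - chi x) * (1 - phi x) - ((x \in A)%:R - phi x)); last by ring.
rewrite (le_trans (ler_normB _ _))// lerD2r normrM ler_piMr//.
by rewrite ger0_norm ?subr_ge0// lerBlDr lerDl.
Qed.

Let approximableU A B : approximable A -> approximable B -> approximable (A `|` B).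
Proof.
move=> [mA Aa] [mB Ba]; split=> [|e e0]; first exact: measurableU.
have e20 : 0 < e / 2 by rewrite divr_gt0.
have [phi tphi phie] := Aa _ e20; have [psi tpsi psie] := Ba _ e20.
have tchi : test (fun x => 1 - (1 - phi x) * (1 - psi x)).
  case: tphi tpsi => [cp p01 p0] [cc c01 c0]; split.
  - by apply: continuous_compl; apply: continuous_mul; exact: continuous_compl.
  - move=> x; have /andP[c1 c2] := c01 x; have /andP[p1 p2] := p01 x.
    rewrite subr_ge0 lerBlDr lerDl mulr_ge0 ?subr_ge0// mulr_ile1 ?subr_ge0//.
    - by rewrite lerBlDr lerDl.
    - by rewrite lerBlDr lerDl.
  - by move=> x Dx; rewrite p0// c0// subr0 mulr1 subrr.
eexists; first exact: tchi.
have -> : e = e / 2 + e / 2 by field.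
apply: le_trans (leeD phie psie); apply: errD => //; first exact: measurableU.
move=> x Dx; have [_ /(_ x) /andP[p0 p1] _] := tphi.
have [_ /(_ x) /andP[q0 q1] _] := tpsi.
rewrite !indicE in_setU.
have -> : ((x \in A) || (x \in B))%:R = 1 - (1 - (x \in A)%:R) * (1 - (x \in B)%:R) :> R.
  by case: (x \in A); case: (x \in B) => /=; ring.
rewrite (_ : _ - _ = ((x \in A)%:R - phi x) * (1 - psi x) +
  (1 - (x \in A)%:R) * ((x \in B)%:R - psi x)); last by ring.
rewrite (le_trans (ler_normD _ _))// !normrM lerD//.
  by rewrite ler_piMr// ger0_norm ?subr_ge0// lerBlDr lerDl.
by rewrite ler_piMl//; case: (_ \in A); rewrite ?subrr ?subr0 ?normr0 ?normr1.
Qed.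

Let approximable_bigcup (F : nat -> set E) :
  (forall i, approximable (F i)) -> approximable (\bigcup_i F i).
Proof.
move=> Fa; have mF i : measurable (F i) by case: (Fa i).
split=> [|e e0]; first exact: bigcup_measurable.
pose G k := \big[setU/set0]_(i < k) F i.
have Ga k : approximable (G k).
  rewrite /G; elim: k => [|k ih]; last by rewrite big_ord_recr; exact: approximableU.
  rewrite big_ord0; split=> // r r0; exists (cst 0) => //.
  rewrite /err integral0_eq ?lee_fin ?(ltW r0)// => x _.
  by rewrite indicE in_set0 subr0 normr0.
have mG k : measurable (G k) by case: (Ga k).
pose H k := D `&` (\bigcup_i F i `\` G k).
have mH k : measurable (H k).
  apply: measurableI => //; apply: measurableD => //; exact: bigcup_measurable.
have H0 : nu (H k) @[k --> \oo] --> 0%E.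
  have HI : \bigcap_k H k = set0.
    apply/seteqP; split=> // x Hx; have [_ [[i _ Fi] _]] := Hx 0%N I.
    have [_ [_]] := Hx i.+1 I; apply.
    by rewrite /G -bigcup_mkord; exists i => //=.
  rewrite -(measure0 nu) -HI; apply: nonincreasing_cvg_mu => //.
  - by apply: le_lt_trans nuD; rewrite le_measure ?inE// => x [].
  - by rewrite HI.
  - apply/nonincreasing_seqP => k; rewrite subsetEset => x [Dx [Fx Gx]].
    by split=> //; split=> // Gk; apply: Gx; rewrite /G big_ord_recr; left.
have e20 : 0 < e / 2 by rewrite divr_gt0.
have [k _ /(_ k (leqnn k)) Hk] := cvge0_le H0 e20.
have [_ /(_ _ e20)[phi tphi phie]] := Ga k.
exists phi => //; have -> : e = e / 2 + e / 2 by field.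
have mU : measurable (\bigcup_i F i) by exact: bigcup_measurable.
apply: (@le_trans _ _ (\int[nu]_(x in D) (\1_(H k) x + `|\1_(G k) x - phi x|)%:E)%E).
  apply: ge0_integral_EFin_le => //; first exact: merr.
    by apply: measurable_funD => //; exact: merr.
  move=> x Dx; rewrite normr_ge0/= -[\1__ x - phi x](subrKA (\1_(G k) x)).
  rewrite (le_trans (ler_normD _ _))// lerD2r !indicE /H in_setI in_setD (mem_set Dx)/=.
  have [|] := boolP (x \in G k); rewrite ?andbT ?andbF//.
    rewrite inE /G -bigcup_mkord => -[i _ Fi].
    by rewrite mem_set ?subrr ?normr0//; exists i.
  by rewrite subr0; case: (_ \in _); rewrite ?normr1 ?normr0.
rewrite ge0_integral_EFinD//; last exact: merr.
by rewrite EFinD leeD// integral_indic// setIidl// => x [].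
Qed.

(** The sets whose indicator is a limit in [L^1(D, nu)] of continuous functions
    vanishing off [D] form a sigma-algebra that contains the open sets. *)
Lemma continuous_approximation A (e : R) : measurable A -> 0 < e ->
  exists phi, [/\ continuous phi, forall x, 0 <= phi x <= 1,
    forall x, ~ D x -> phi x = 0 &
    (\int[nu]_(x in D) `|\1_A x - phi x|%:E <= e%:E)%E].
Proof.
move=> mA e0; have [_ /(_ e e0)[phi [? ? ?] ?]] : approximable A.
  have sG : sigma_algebra setT approximable.
    split.
    - by apply: approximable_open; exact: open0.
    - by move=> B; rewrite setTD; exact: approximableC.
    - exact: approximable_bigcup.
  exact: (smallest_sub sG approximable_open mA).
by exists phi.
Qed.

End continuous_approximation.

(** * Vector measures and their densities *)

Section vector_measure.
Context {R : realType} {d : nat} {V : vectType R}.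
Variables (dot : {dot V for idfun}) (Om : set 'rV[R]_d) (mu : vmeasure dot Om).
Implicit Types A B D : set 'rV[R]_d.

Local Notation dnorm := (dnorm dot).
Local Notation c i := (coord (vbasis {:V}) i).
Local Notation b := (vbasis {:V}).

Lemma vmeasure0 : mu set0 = 0.
Proof. by apply: vmeasure_out; rewrite ?set0I. Qed.

Lemma coord_sigma_additive i (F : nat -> set 'rV[R]_d) :
  (forall k, measurable (F k)) -> trivIset setT F ->
  \sum_(0 <= k < n) c i (mu (F k)) @[n --> \oo] --> c i (mu (\bigcup_k F k)).
Proof.
move=> mF tF; have [C C0 cC] := coord_bound dot.
apply/cvgrPdist_le => e e0; have eC : 0 < e / C by rewrite divr_gt0.
have /cvgrPdist_le/(_ _ eC) := vmeasure_sigma_additive mu mF tF.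
apply: filterS => n; rewrite sub0r normrN (ger0_norm (dnorm_nneg _ _)) => h.
rewrite big_mkord -linear_sum -linearB (le_trans (cC _ _))//.
by rewrite -ler_pdivlMl// mulrC.
Qed.

Section coordinate_charge.
Variables (D : set 'rV[R]_d) (mD : measurable D) (i : 'I_(\dim {:V})).

Definition coord_charge of measurable D := fun A => (c i (mu (A `&` D)))%:E.

Local Notation nu := (coord_charge mD).

Let nu0 : nu set0 = 0%E.
Proof. by rewrite /coord_charge set0I vmeasure0 linear0. Qed.

Let nu_fin A : measurable A -> nu A \is a fin_num. Proof. by []. Qed.

Let nu_sigma_additive : semi_sigma_additive nu.
Proof.
move=> F mF tF mUF; rewrite /coord_charge setI_bigcupl.
under eq_fun do rewrite sumEFin.
apply: cvg_EFin; first exact: nearW.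
apply: coord_sigma_additive; first by move=> k; exact: measurableI.
exact: trivIset_setIr.
Qed.

HB.instance Definition _ := isCharge.Build _ _ R nu nu0 nu_fin nu_sigma_additive.

End coordinate_charge.

(** The Radon-Nikodym theorem is applied to each coordinate. *)
Lemma vmeasure_density (m : {sigma_finite_measure set 'rV[R]_d -> \bar R}) D :
  measurable D ->
  (forall A, measurable A -> A `<=` D -> m A = 0%E -> mu A = 0) ->
  exists g, is_density dot mu m D g.
Proof.
move=> mD mu_m.
have dom i : (coord_charge i mD : {charge set _ -> \bar R}) `<< m.
  apply/null_content_dominatesP => A mA mA0; rewrite /= /coord_charge mu_m ?linear0//.
  - exact: measurableI.
  - by apply: (subset_measure0 _ mA) => //; exact: measurableI.
pose rn i (x : 'rV[R]_d) := fine (Radon_Nikodym (coord_charge i mD) m x).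
have rnE i x : (rn i x)%:E = (Radon_Nikodym (coord_charge i mD) m x).
  by rewrite /rn fineK//; exact: Radon_Nikodym_fin_num.
have rni i : m.-integrable setT (EFin \o rn i).
  have := Radon_Nikodym_integrable (dom i); apply: eq_integrable => // x _.
  by rewrite /= rnE.
pose g (x : 'rV[R]_d) := \sum_(i < \dim {:V}) rn i x *: b`_i.
have cg i x : c i (g x) = rn i x by exact: coord_vsum.
have rniD i : m.-integrable D (EFin \o rn i) by exact: integrableS (rni i).
have mg : vmeasurable dot D g.
  apply/vmeasurableP => // i; under eq_fun do rewrite cg.
  exact: integrable_measurable (rniD i).
exists g; split=> //.
  have : m.-integrable D (fun x => \sum_(i < \dim {:V}) ((dnorm b`_i)%:E * `|(rn i x)%:E|))%E.
    apply: integrable_sum => // i _; apply: integrableZl => //.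
    exact: (integrable_abse (rniD i)).
  move=> /integrableP[mS]; apply: le_lt_trans; apply: ge0_le_integral => //.
  - by move=> x _; rewrite lee_fin dnorm_nneg.
  - by apply/measurable_EFinP; exact: measurable_dnorm.
  - exact: measurableT_comp.
  - move=> x _; apply: le_trans (lee_abs _).
    rewrite (eq_bigr (fun i => (`|c i (g x)| * dnorm b`_i)%:E)); last first.
      by move=> i _; rewrite cg mulrC.
    by rewrite sumEFin lee_fin dnorm_coord.
move=> A mA AD; apply: eq_coord => i; rewrite /vintegral coord_vsum.
rewrite (eq_integral (Radon_Nikodym (coord_charge i mD) m)); last first.
  by move=> x _; rewrite cg rnE.
rewrite -Radon_Nikodym_integral//; by rewrite -[in LHS](setIidl AD).
Qed.

End vector_measure.

(** * The total variation and the polar *)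

Section eq_setfun_integral.
Import HBNNSimple.

(** The integral only looks at the values of the measure on measurable sets. *)
Lemma eq_setfun_integral d (T : measurableType d) (R : realType)
    (m1 m2 : set T -> \bar R) (D : set T) (f : T -> \bar R) :
  (forall A, measurable A -> m1 A = m2 A) ->
  (\int[m1]_(x in D) f x = \int[m2]_(x in D) f x)%E.
Proof.
move=> m12; rewrite /integral.
have E (h : {nnsfun T >-> R}) : sintegral m1 h = sintegral m2 h.
  by apply: eq_fsbigr => r _; rewrite m12//; exact: measurable_funPTI.
by congr (ereal_sup _ - ereal_sup _)%E; apply/seteqP; split=> _ [h hf <-]; exists h.
Qed.

End eq_setfun_integral.

Lemma nneseries_interleave (R : realType) (f g h : nat -> \bar R) :
  (forall k, 0 <= h k)%E ->
  (forall k, h k.*2 = f k) -> (forall k, h k.*2.+1 = g k) ->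
  (\sum_(0 <= k <oo) f k + \sum_(0 <= k <oo) g k <= \sum_(0 <= k <oo) h k)%E.
Proof.
move=> h0 hf hg.
have f0 k : (0 <= f k)%E by rewrite -hf.
have g0 k : (0 <= g k)%E by rewrite -hg.
rewrite -nneseriesD//; apply: lime_le; first by apply: is_cvg_nneseries => *; exact: adde_ge0.
apply: nearW => n; apply: le_trans (nneseries_lim_ge n.*2 _) => //.
rewrite le_eqVlt; apply/orP; left; apply/eqP.
elim: n => [|n ih]; first by rewrite !big_geq.
by rewrite doubleS !big_nat_recr//= ih hf hg addeA.
Qed.

Section total_variation.
Context {R : realType} {d : nat} {V : vectType R}.
Variables (dot : {dot V for idfun}) (Om : set 'rV[R]_d) (mu : vmeasure dot Om).
Implicit Types A B D : set 'rV[R]_d.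
Implicit Types F G : nat -> set 'rV[R]_d.

Local Notation dnorm := (dnorm dot).
Local Notation c i := (coord (vbasis {:V}) i).
Local Notation b := (vbasis {:V}).
Local Notation var := (variation_measure dot mu).

Let part A F := [/\ forall k, measurable (F k), trivIset setT F & \bigcup_k F k = A].
Let vsum F : \bar R := (\sum_(0 <= k <oo) (dnorm (mu (F k)))%:E)%E.

Let dn0 v : (0 <= (dnorm v)%:E)%E. Proof. by rewrite lee_fin dnorm_nneg. Qed.

Let vsum_le_var A F : part A F -> (vsum F <= var A)%E.
Proof. by move=> [mF tF FA]; apply: ereal_sup_ubound; exists F. Qed.

Let var_le A (x : \bar R) : (forall F, part A F -> (vsum F <= x)%E) -> (var A <= x)%E.
Proof. by move=> h; apply: ge_ereal_sup => _ [F [mF tF FA ->]]; exact: h. Qed.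

Let part_bigcup2 A B : measurable A -> measurable B -> [disjoint A & B] ->
  part (A `|` B) (bigcup2 A B).
Proof.
move=> mA mB AB; split; [|by rewrite -trivIset_bigcup2; apply/eqP; rewrite -disj_set2E|exact: bigcup2E].
by move=> [|[|k]] /=.
Qed.

Let vsum_bigcup2 A B :
  vsum (bigcup2 A B) = ((dnorm (mu A))%:E + (dnorm (mu B))%:E)%E.
Proof.
rewrite /vsum (nneseries_split 0 2)//= eseries0 ?adde0.
  by rewrite !big_nat_recr//= big_geq// add0e.
by move=> [|[|k]]//= _ _; rewrite vmeasure0 dnorm0.
Qed.

Lemma dnorm_le_variation A : measurable A -> ((dnorm (mu A))%:E <= var A)%E.
Proof.
move=> mA; have : [disjoint A & set0] by rewrite disj_set2E setI0.
move=> /(part_bigcup2 mA measurable0); rewrite setU0 => /vsum_le_var; rewrite vsum_bigcup2 vmeasure0 dnorm0 adde0.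
by [].
Qed.

Let var_ge0 A : measurable A -> (0 <= var A)%E.
Proof. by move=> mA; apply: le_trans (dnorm_le_variation mA); exact: dn0. Qed.

(** The Hahn decompositions of the coordinates bound the total variation. *)
Lemma variation_finite A : measurable A -> (var A < +oo)%E.
Proof.
move=> mA.
pose nu i : {charge set 'rV[R]_d -> \bar R} := coord_charge mu i measurableT.
have H i : exists PN, hahn_decomposition (nu i) PN.1 PN.2.
  by have [P [N h]] := Hahn_decomposition (nu i); exists (P, N).
have /choice[PN hPN] := H.
pose w i : {measure set 'rV[R]_d -> \bar R} := charge_variation (hPN i).
have wA i : (w i A < +oo)%E by rewrite -ge0_fin_numE//; exact: (fin_num_measure (charge_variation (hPN i))).
apply: (@le_lt_trans _ _ (\sum_(i < \dim {:V}) (dnorm b`_i)%:E * w i A)%E); last first.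
  by apply: lte_sum_pinfty => i _; rewrite lte_mul_pinfty.
apply: var_le => F [mF tF FA].
apply: (@le_trans _ _ (\sum_(0 <= k <oo) \sum_(i < \dim {:V}) (dnorm b`_i)%:E * w i (F k))%E).
  apply: lee_nneseries => // k _.
  apply: (@le_trans _ _ (\sum_(i < \dim {:V}) (dnorm b`_i * `|c i (mu (F k))|)%:E)%E).
    rewrite sumEFin lee_fin (le_trans (dnorm_coord dot _))// ler_sum// => i _.
    by rewrite mulrC.
  apply: lee_sum => i _; rewrite EFinM lee_wpmul2l//.
  apply: le_trans (abse_charge_variation (hPN i) (mF k)).
  by rewrite /= /coord_charge setIT.
rewrite nneseries_sum; last by move=> i k _; rewrite mule_ge0.
apply: lee_sum => i _; rewrite nneseriesZl// lee_wpmul2l// -FA.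
by rewrite measure_semi_bigcup// FA.
Qed.

Let var_fin A : measurable A -> var A \is a fin_num.
Proof. by move=> mA; rewrite ge0_fin_numE ?var_ge0// variation_finite. Qed.

Let var_set0 : var set0 = 0%E.
Proof.
apply/eqP; rewrite eq_le var_ge0// andbT; apply: var_le => F [mF _ F0].
rewrite /vsum eseries0// => k _ _; have -> : F k = set0.
  by rewrite -subset0 -F0; exact: bigcup_sup.
by rewrite vmeasure0 dnorm0.
Qed.

(* Partitions of two disjoint sets are interleaved into one of their union. *)
Let var_superadditive A B : measurable A -> measurable B -> A `&` B = set0 ->
  (var A + var B <= var (A `|` B))%E.
Proof.
move=> mA mB AB; have mAB : measurable (A `|` B) by exact: measurableU.
have fg F G : part A F -> part B G -> (vsum F + vsum G <= var (A `|` B))%E.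
  move=> [mF tF FA] [mG tG GB].
  pose H k := if odd k then G k./2 else F k./2.
  have HA k : F k `<=` A by rewrite -FA; exact: bigcup_sup.
  have HB k : G k `<=` B by rewrite -GB; exact: bigcup_sup.
  have pH : part (A `|` B) H.
    split.
    - by move=> k; rewrite /H; case: ifP.
    - apply/trivIsetP => i j _ _ ij; rewrite /H.
      have AB0 k l : F k `&` G l = set0.
        by rewrite -subset0 -AB; apply: setISS.
      case: (boolP (odd i)) => oi; case: (boolP (odd j)) => oj.
      + move/trivIsetP : tG; apply => //; apply: contra ij => /eqP ij2.
        by rewrite -(odd_double_half i) -(odd_double_half j) oi oj ij2.
      + by rewrite setIC.
      + by [].
      + move/trivIsetP : tF; apply => //; apply: contra ij => /eqP ij2.
        by rewrite -(odd_double_half i) -(odd_double_half j) (negbTE oi) (negbTE oj) ij2.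
    - apply/seteqP; split=> x.
        by move=> [k _]; rewrite /H; case: ifP => _ => [/HB|/HA]; [right|left].
      rewrite -FA -GB => -[[k _ Fk]|[k _ Gk]].
        by exists k.*2 => //; rewrite /H odd_double doubleK.
      by exists k.*2.+1 => //; rewrite /H /= odd_double/= uphalf_double.
  apply: le_trans (vsum_le_var pH); apply: nneseries_interleave => //.
    by move=> k; rewrite /H odd_double doubleK.
  by move=> k; rewrite /H /= odd_double/= uphalf_double.
rewrite -leeBrDr ?var_fin//; apply: var_le => F pF.
rewrite leeBrDr ?var_fin// addeC.
have Ffin : vsum F \is a fin_num.
  rewrite ge0_fin_numE ?nneseries_ge0//.
  exact: le_lt_trans (vsum_le_var pF) (variation_finite mA).
rewrite -leeBrDr//; apply: var_le => G pG.
by rewrite leeBrDr// addeC fg.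
Qed.

Let le_var A B : measurable A -> measurable B -> A `<=` B -> (var A <= var B)%E.
Proof.
move=> mA mB AB; have mBA : measurable (B `\` A) by exact: measurableD.
have := var_superadditive mA mBA; rewrite setDE setICA setICr setI0 => /(_ erefl).
rewrite -setDE setDUK//; apply: le_trans; rewrite leeDl// var_ge0//.
Qed.

Let var_sum_le F n : (forall k, measurable (F k)) -> trivIset setT F ->
  (\sum_(0 <= k < n) var (F k) <= var (\big[setU/set0]_(k < n) F k))%E.
Proof.
move=> mF tF; elim: n => [|n ih]; first by rewrite big_geq// big_ord0 var_set0.
rewrite big_nat_recr//= big_ord_recr/=.
have mU : measurable (\big[setU/set0]_(k < n) F k) by exact: bigsetU_measurable.
apply: le_trans (var_superadditive mU (mF n) _); first by rewrite leeD2r.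
rewrite -bigcup_mkord setI_bigcupl bigcup0// => k /= kn.
by move/trivIsetP : tF; apply => //; rewrite ltn_eqF.
Qed.

(* The finite triangle inequalities pass to the limit by sigma-additivity. *)
Let dnorm_bigcup_le A F : part A F -> ((dnorm (mu A))%:E <= vsum F)%E.
Proof.
move=> [mF tF FA]; apply/lee_addgt0Pr => e e0.
have /cvgrPdist_le/(_ _ e0)[n _ /(_ n (leqnn n))] := vmeasure_sigma_additive mu mF tF.
rewrite FA sub0r normrN ger0_norm ?dnorm_nneg// => h.
apply: (@le_trans _ _ ((\sum_(k < n) dnorm (mu (F k)) + e)%:E)).
  rewrite lee_fin -[mu A](subrK (\sum_(k < n) mu (F k))).
  by rewrite (le_trans (ler_dnormD _ _ _))// addrC lerD// dnorm_sum.
rewrite EFinD leeD2r// -sumEFin -(big_mkord xpredT (fun k => (dnorm (mu (F k)))%:E)).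
exact: nneseries_lim_ge.
Qed.

Let var_sigma_additive F : (forall k, measurable (F k)) -> trivIset setT F ->
  (\sum_(0 <= k < n) var (F k))%E @[n --> \oo] --> var (\bigcup_k F k).
Proof.
move=> mF tF; have mU : measurable (\bigcup_k F k) by exact: bigcup_measurable.
have vF k : (0 <= var (F k))%E by exact: var_ge0.
suff <- : (\sum_(0 <= k <oo) var (F k))%E = var (\bigcup_k F k).
  exact: is_cvg_nneseries.
apply/eqP; rewrite eq_le; apply/andP; split.
  apply: lime_le; first exact: is_cvg_nneseries.
  apply: nearW => n; apply: le_trans (var_sum_le n mF tF) _.
  apply: le_var => //; first exact: bigsetU_measurable.
  by rewrite -bigcup_mkord => x [k _ Fk]; exists k.
apply: var_le => G [mG tG GF].
apply: (@le_trans _ _ (\sum_(0 <= k <oo) \sum_(0 <= l <oo)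
    (dnorm (mu (G k `&` F l)))%:E)%E).
  apply: lee_nneseries => // k _; apply: dnorm_bigcup_le; split.
  - by move=> l; exact: measurableI.
  - exact: trivIset_setIl.
  - rewrite -setI_bigcupr -GF; apply: setIidl; exact: bigcup_sup.
rewrite nneseries_interchange//; apply: lee_nneseries => [l _ _|l _].
  exact: nneseries_ge0.
apply: vsum_le_var; split.
- by move=> k; exact: measurableI.
- exact: trivIset_setIr.
- rewrite -setI_bigcupl GF; apply: setIidr; exact: bigcup_sup.
Qed.

(** [variation_measure] is an empty supremum, hence [-oo], on nonmeasurable
    sets; this variant is nonnegative everywhere. *)
Definition tvar A : \bar R := if A \in measurable then var A else 0%E.

Let tvarE A : measurable A -> tvar A = var A.
Proof. by move=> mA; rewrite /tvar mem_set. Qed.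

Let tvar0 : tvar set0 = 0%E. Proof. by rewrite tvarE. Qed.

Let tvar_ge0 A : (0 <= tvar A)%E.
Proof. by rewrite /tvar; case: ifPn => //; rewrite inE => /var_ge0. Qed.

Let tvar_sigma_additive : semi_sigma_additive tvar.
Proof.
move=> F mF tF mU; rewrite tvarE//.
by under eq_fun do under eq_bigr do rewrite tvarE//; exact: var_sigma_additive.
Qed.

HB.instance Definition _ := isMeasure.Build _ _ _ tvar
  tvar0 tvar_ge0 tvar_sigma_additive.

Let tvar_fin : fin_num_fun tvar.
Proof. by move=> A mA; rewrite tvarE// var_fin. Qed.

HB.instance Definition _ := Measure_isFinite.Build _ _ _ tvar tvar_fin.

(** The polar is defined by choice, so this rests on the existence of a density:
    null sets of the total variation are null for [mu], hence Radon-Nikodym. *)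
Lemma polar_density : measurable Om ->
  exists m : {finite_measure set 'rV[R]_d -> \bar R},
    (forall D (f : 'rV[R]_d -> \bar R),
      \int[var]_(x in D) f x = \int[m]_(x in D) f x)%E /\
    is_density dot mu m Om (polar mu).
Proof.
move=> mOm; exists tvar.
have varE D (f : 'rV[R]_d -> \bar R) :
    (\int[var]_(x in D) f x = \int[tvar]_(x in D) f x)%E.
  by apply: eq_setfun_integral => A mA; rewrite tvarE.
split=> //.
have densE g : is_density dot mu var Om g <-> is_density dot mu tvar Om g.
  have vE A f : vintegral var A f = vintegral tvar A f :> V.
    by apply: eq_bigr => i _; rewrite varE.
  have iE : (\int[var]_(x in Om) (dnorm (g x))%:E =
             \int[tvar]_(x in Om) (dnorm (g x))%:E)%E by exact: varE.
  split=> -[mg gi mug]; split=> //.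
  - by rewrite -iE.
  - by move=> A mA AO; rewrite mug// vE.
  - by rewrite iE.
  - by move=> A mA AO; rewrite mug// vE.
apply/densE; rewrite /polar; case: xgetP => [g _ //|noP].
have [g /densE gd] : exists g, is_density dot mu tvar Om g.
  apply: (@vmeasure_density _ _ _ _ _ mu tvar) => // A mA AOm A0.
  have : ((dnorm (mu A))%:E <= 0)%E.
    by rewrite -A0 /= tvarE// dnorm_le_variation.
  by rewrite lee_fin => m0; apply: (@dnorm0_eq0 _ _ dot); apply/eqP; rewrite eq_le m0 dnorm_nneg.
by case: (noP g).
Qed.

End total_variation.

(** * Densities with respect to Lebesgue measure *)

Section lebesgue_Lp.
Context {R : realType} {d : nat} {V : vectType R}.
Variable dot : {dot V for idfun}.
Implicit Types (D : set 'rV[R]_d) (f g : 'rV[R]_d -> V).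

Local Notation dnorm := (dnorm dot).
Local Notation c i := (coord (vbasis {:V}) i).
Local Notation b := (vbasis {:V}).
Local Notation leb := (lebesgue_rV R d).

Lemma lebesgue_bounded D : bounded_set D -> measurable D -> (leb D < +oo)%E.
Proof.
move=> [M [_ MD]] mD; pose N := `|M| + 1.
have DN : D `<=` rV_box (fun=> `[- N, N]%classic).
  have MN : M < N by rewrite /N (le_lt_trans (ler_norm M))// ltrDl.
  move=> x Dx i /=; rewrite in_itv/= -ler_norml (le_trans _ (MD N MN x Dx))//.
  by rewrite [leRHS]mx_normrE; exact: (le_bigmax _ (fun ij => `|x ij.1 ij.2|) (0, i)).
apply: (@le_lt_trans _ _ (leb (rV_box (fun=> `[- N, N]%classic)))).
  by apply: le_measure; rewrite ?inE//; exact: measurable_rV_box.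
rewrite lebesgue_rV_box//.
set P := (X in (X < _)%E); suff : (0 <= P < +oo)%E by case/andP.
rewrite /P; elim/big_ind : _ => [|x y /andP[x0 xoo] /andP[y0 yoo]|i _].
- by rewrite lee01 ltry.
- by rewrite mule_ge0//= lte_mul_pinfty// ge0_fin_numE.
- by rewrite measure_ge0/= lebesgue_measure_itv/=; case: ifPn; rewrite ?ltry.
Qed.

Lemma Lp_norm_powR D f (r : R) : 0 < r ->
  (Lp_norm dot D r%:E f `^ r = \int[leb]_(x in D) (dnorm (f x) `^ r)%:E)%E.
Proof.
move=> r0; rewrite /Lp_norm poweR_Lnorm ?gt_eqF// [RHS]integral_mkcond.
apply: eq_integral => x _; rewrite !patchE; case: ifPn => _.
  by rewrite gee0_abs ?lee_fin ?dnorm_nneg// poweR_EFin.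
by rewrite abse0 poweR0r// gt_eqF.
Qed.

Lemma in_LpP D f (r : R) : 0 < r -> in_Lp dot D r%:E f <->
  vmeasurable dot D f /\ (\int[leb]_(x in D) (dnorm (f x) `^ r)%:E < +oo)%E.
Proof.
move=> r0; rewrite -Lp_norm_powR//; split=> -[mf foo]; split=> //.
  exact: poweR_lty.
by apply: lty_poweRy foo; rewrite gt_eqF.
Qed.

Lemma Lp_norm_leP D f (r B : R) : 0 < r -> 0 <= B ->
  (Lp_norm dot D r%:E f <= B%:E)%E =
  (\int[leb]_(x in D) (dnorm (f x) `^ r)%:E <= (B `^ r)%:E)%E.
Proof.
move=> r0 B0; rewrite -Lp_norm_powR// -poweR_EFin.
have N0 : (0 <= Lp_norm dot D r%:E f)%E by exact: Lnorm_ge0.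
have I (x : \bar R) : (0 <= x)%E -> x \in `[0%E, +oo%E].
  by move=> x0; rewrite in_itv/= leey andbT.
apply/idP/idP => h.
  by apply: gt0_ler_poweR h; rewrite ?(ltW r0)//; apply: I; rewrite ?lee_fin.
have : ((Lp_norm dot D r%:E f `^ r) `^ r^-1 <= (B%:E `^ r) `^ r^-1)%E.
  apply: gt0_ler_poweR h; rewrite ?invr_ge0 ?(ltW r0)//; apply: I; exact: poweR_ge0.
by rewrite -!poweRrM mulfV ?gt_eqF// !poweRe1.
Qed.

Section density.
Variables (Om D : set 'rV[R]_d) (mu : vmeasure dot Om).
Variable m : {measure set 'rV[R]_d -> \bar R}.
Hypothesis mD : measurable D.

Lemma density_coord f i : is_density dot mu m D f ->
  m.-integrable D (EFin \o (fun x => c i (f x))) /\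
  forall A, measurable A -> A `<=` D -> \int[m]_(x in A) c i (f x) = c i (mu A).
Proof.
move=> [mf foo fmu]; split; last first.
  by move=> A mA AD; rewrite fmu// /vintegral coord_vsum.
have [C C0 cC] := coord_bound dot.
apply: (@integrable_le _ _ _ _ _ mD _ (fun x => C * dnorm (f x))).
- by move: mf => /vmeasurableP; exact.
- have : m.-integrable D (EFin \o (fun x => dnorm (f x))).
    apply/integrableP; split; first by apply/measurable_EFinP; exact: measurable_dnorm.
    by under eq_integral do rewrite (gee0_abs (dnorm_nneg _ _ : (0 <= _%:E)%E)).
  by move/(integrableZl mD C); apply: eq_integrable.
- by move=> x _; exact: cC.
Qed.

(** The coordinates of two densities have the same integral over every set. *)
Lemma density_unique f g : is_density dot mu m D f -> is_density dot mu m D g ->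
  {ae m, forall x, D x -> f x = g x}.
Proof.
move=> df dg.
have h i : {ae m, forall x, D x -> (c i (f x))%:E = (c i (g x))%:E}.
  have [fi fE] := density_coord i df; have [gi gE] := density_coord i dg.
  apply: (integral_ae_eq mD fi); first exact: measurable_int gi.
  move=> A AD mA; rewrite -!EFin_Rintegral//.
  - by rewrite fE// gE.
  - exact: integrableS gi.
  - exact: integrableS fi.
have : {ae m, forall x, forall i, D x -> (c i (f x))%:E = (c i (g x))%:E}.
  exact: filter_forall.
by apply: filterS => x fg Dx; apply: eq_coord => i; have [] := fg i Dx.
Qed.

Lemma density_integral_powR f g (r : R) :
  is_density dot mu m D f -> is_density dot mu m D g ->
  (\int[m]_(x in D) (dnorm (f x) `^ r)%:E =
   \int[m]_(x in D) (dnorm (g x) `^ r)%:E)%E.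
Proof.
move=> df dg; have [mf _ _] := df; have [mg _ _] := dg.
apply: ge0_ae_eq_integral => //.
- by apply/measurable_EFinP/measurable_fun_powR; exact: measurable_dnorm.
- by apply/measurable_EFinP/measurable_fun_powR; exact: measurable_dnorm.
- by move=> x _; rewrite lee_fin powR_ge0.
- by move=> x _; rewrite lee_fin powR_ge0.
- by apply: filterS (density_unique df dg) => x fg Dx; rewrite fg.
Qed.

End density.

End lebesgue_Lp.

(** * From weak-star to setwise convergence *)

Section small_test_functions.
Context d (T : measurableType d) (R : realType).
Variables (m : {measure set T -> \bar R}) (D : set T).
Hypothesis mD : measurable D.
Implicit Types k psi a phi : T -> R.

(** The estimate depends on [k] only through its bound in [L^p]: it will be used
    uniformly along the sequence of densities. *)
Lemma integral_mul_small_Lp k psi (t p B del : R) :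
  measurable_fun D k -> measurable_fun D psi ->
  (forall x, D x -> 0 <= psi x <= 1) -> 0 < t -> 1 <= p ->
  (\int[m]_(x in D) (`|k x| `^ p)%:E <= B%:E)%E ->
  (\int[m]_(x in D) (psi x)%:E <= del%:E)%E ->
  (\int[m]_(x in D) (`|k x| * psi x)%:E <= (t * del + t `^ (1 - p) * B)%:E)%E.
Proof.
move=> mk mpsi psi01 t0 p1 kB psid.
have mkp := measurable_fun_norm_powR p mk.
have m1 : measurable_fun D (fun x => t * psi x) by exact: measurable_funM.
have m2 : measurable_fun D (fun x => t `^ (1 - p) * `|k x| `^ p).
  exact: measurable_funM.
have ps (a r : R) : 0 <= a `^ r by exact: powR_ge0.
have psi0 x : D x -> 0 <= psi x by move=> /psi01/andP[].
apply: (@le_trans _ _ (\int[m]_(x in D)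
    (t * psi x + t `^ (1 - p) * `|k x| `^ p)%:E)%E).
  apply: ge0_integral_EFin_le => //.
  - by apply: measurable_funM => //; exact: measurableT_comp.
  - exact: measurable_funD.
  - move=> x Dx; have /andP[p0x p1x] := psi01 _ Dx; rewrite mulr_ge0//=.
    apply: (@le_trans _ _ ((t + t `^ (1 - p) * `|k x| `^ p) * psi x)).
      rewrite ler_wpM2r//.
      by have := powR_interp (normr_ge0 (k x)) t0 ler01 p1; rewrite !powRr1 ?(ltW t0).
    by rewrite mulrDl lerD2l ler_piMr// mulr_ge0.
rewrite ge0_integral_EFinD//.
- rewrite EFinD leeD// ge0_integral_EFinZ ?(ltW t0)// EFinM lee_wpmul2l ?lee_fin ?(ltW t0)//.
- by move=> x Dx; rewrite mulr_ge0 ?(ltW t0) ?psi0.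
- by move=> x _; rewrite mulr_ge0.
Qed.

(** The same for a single integrable function, such as a coordinate of the polar of
    the limit measure. *)
Lemma integral_mul_small k (e : R) : m.-integrable D (EFin \o k) -> 0 < e ->
  exists2 del : R, 0 < del & forall psi, measurable_fun D psi ->
    (forall x, D x -> 0 <= psi x <= 1) ->
    (\int[m]_(x in D) (psi x)%:E <= del%:E)%E ->
    (\int[m]_(x in D) (`|k x| * psi x)%:E <= e%:E)%E.
Proof.
move=> ki e0; have mk := integrable_measurable ki.
have mnk : measurable_fun D (fun x => `|k x|) by exact: measurableT_comp.
have e20 : 0 < e / 2 by rewrite divr_gt0.
have [n _ /(_ n (leqnn n))] := cvge0_le (integral_tail_cvg0 mD mnk
  (integrable_norm ki) (fun x _ => normr_ge0 (k x))) e20.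
set E := D `&` _ => En; have mE : measurable E by exact: measurable_set_lt.
exists (e / 2 / n.+1%:R); first by rewrite divr_gt0.
move=> psi mpsi psi01 psid.
have m1 : measurable_fun D (fun x => n%:R * psi x) by exact: measurable_funM.
have m2 : measurable_fun D (fun x => `|k x| * \1_E x) by exact: measurable_funM.
have psi0 x : D x -> 0 <= psi x by move=> /psi01/andP[].
apply: (@le_trans _ _ (\int[m]_(x in D)
    (n%:R * psi x + `|k x| * \1_E x)%:E)%E).
  apply: ge0_integral_EFin_le => //.
  - by apply: measurable_funM.
  - exact: measurable_funD.
  - move=> x Dx; have /andP[p0x p1x] := psi01 _ Dx; rewrite mulr_ge0//=.
    rewrite indicE; have [xE|xE] := boolP (x \in E).
      by rewrite mulr1 ler_wpDl ?mulr_ge0// ler_piMr.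
    rewrite mulr0 addr0 ler_wpM2r// leNgt; apply: contra xE => kx.
    by rewrite inE.
rewrite ge0_integral_EFinD//.
- rewrite [e]splitr EFinD leeD// ge0_integral_EFinZ//.
  apply: (@le_trans _ _ (n%:R%:E * (e / 2 / n.+1%:R)%:E)%E).
    by rewrite lee_wpmul2l// lee_fin.
  by rewrite -EFinM lee_fin mulrCA ler_piMr ?(ltW e20)// ler_pdivrMr// mul1r ler_nat.
- by move=> x Dx; rewrite mulr_ge0 ?psi0.
Qed.

Lemma integral_approx_error k a phi : m.-integrable D (EFin \o k) ->
  measurable_fun D a -> measurable_fun D phi ->
  (forall x, D x -> 0 <= a x <= 1) -> (forall x, D x -> 0 <= phi x <= 1) ->
  (`|\int[m]_(x in D) (k x * a x) - \int[m]_(x in D) (k x * phi x)|%:E <=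
   \int[m]_(x in D) (`|k x| * `|a x - phi x|)%:E)%E.
Proof.
move=> ki ma mphi a01 phi01.
have b01 (u : T -> R) : (forall x, D x -> 0 <= u x <= 1) ->
    forall x, D x -> `|u x| <= 1.
  by move=> u01 x Dx; have /andP[u0 u1] := u01 _ Dx; rewrite ger0_norm.
have i1 := integrable_mul_bounded mD ki ma (b01 _ a01).
have i2 := integrable_mul_bounded mD ki mphi (b01 _ phi01).
have i3 := integrableB mD i1 i2.
rewrite -RintegralB//.
apply: (@le_trans _ _ (\int[m]_(x in D) `|k x * a x - k x * phi x|)%:E).
  by rewrite lee_fin le_normr_Rintegral.
rewrite EFin_Rintegral//; last exact: (integrable_norm i3).
rewrite le_eqVlt; apply/orP; left; apply/eqP; apply: eq_integral => x _.
by rewrite -mulrBr normrM.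
Qed.

End small_test_functions.

Section weak_star.
Context {R : realType} {d : nat} {V : vectType R}.
Variables (dot : {dot V for idfun}) (Om D : set 'rV[R]_d).
Implicit Types (phi : 'rV[R]_d -> R) (mu : vmeasure dot Om).
Hypothesis oOm : open Om.
Hypothesis oD : open D.
Hypothesis cD : compact (closure D).
Hypothesis DOm : closure D `<=` Om.

Local Notation dnorm := (dnorm dot).
Local Notation c i := (coord (vbasis {:V}) i).
Local Notation leb := (lebesgue_rV R d).

Let mD : measurable D. Proof. exact: mx_open_measurable. Qed.
Let mOm : measurable Om. Proof. exact: mx_open_measurable. Qed.
Let sDOm : D `<=` Om.
Proof. by apply: subset_trans DOm; exact: subset_closure. Qed.

Lemma is_density_sub mu (m : {measure set 'rV[R]_d -> \bar R}) f :
  is_density dot mu m Om f -> is_density dot mu m D f.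
Proof.
move=> [mf fi fmu]; split.
- by move=> w; apply: measurable_funS (mf w).
- apply: le_lt_trans fi; apply: ge0_subset_integral => //.
    by apply/measurable_EFinP; exact: measurable_dnorm.
  by move=> x _; rewrite lee_fin dnorm_nneg.
- by move=> A mA AD; rewrite fmu//; exact: subset_trans sDOm.
Qed.

(** Setwise convergence of constant sequences. *)
Lemma density_integral_bounded mu (m m' : {measure set 'rV[R]_d -> \bar R})
    f f' i phi M :
  is_density dot mu m D f -> is_density dot mu m' D f' ->
  measurable_fun D phi -> (forall x, D x -> `|phi x| <= M) ->
  \int[m]_(x in D) (c i (f x) * phi x) = \int[m']_(x in D) (c i (f' x) * phi x).
Proof.
move=> df df' mphi phiM.
have [fi fE] := density_coord mD i df; have [fi' fE'] := density_coord mD i df'.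
have := @setwise_cvg_bounded _ _ _ (fun=> m) m' D (fun=> fun x => c i (f x))
  (fun x => c i (f' x)) _ mD (fun=> fi) fi' (fun=> lexx _).
have H A : measurable A -> A `<=` D ->
    \int[m]_(x in A) c i (f x) @[_ --> \oo] --> \int[m']_(x in A) c i (f' x).
  by move=> mA AD; rewrite fE// fE'//; exact: cvg_cst.
move=> /(_ H _ _ mphi phiM) /cvg_lim <-//.
by apply/esym/cvg_lim => //; exact: cvg_cst.
Qed.

Lemma integral_against_coord mu (m : {measure set 'rV[R]_d -> \bar R}) f i phi M :
  is_density dot mu m D f -> measurable_fun D phi ->
  (forall x, `|phi x| <= M) -> (forall x, ~ D x -> phi x = 0) ->
  c i (integral_against phi mu) = \int[m]_(x in D) (c i (f x) * phi x).
Proof.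
move=> df mphi phiM phi0.
have [n [varE /is_density_sub dpolar]] := polar_density mu mOm.
rewrite -(density_integral_bounded i dpolar df mphi (fun x _ => phiM x)).
rewrite /integral_against /vintegral coord_vsum varE.
transitivity (\int[n]_(x in Om `&` D) (c i (polar mu x) * phi x)).
  rewrite Rintegral_mkcondr /Rintegral; congr fine; apply: eq_integral => x _.
  rewrite linearZ/= patchE; case: ifPn => [_|]; first by rewrite mulrC.
  by move=> /negP; rewrite inE => xD; rewrite phi0// mul0r.
by rewrite setIidr.
Qed.

(** Where [|phi| >= e] the point lies in [D], whose closure is compact. *)
Lemma C0_fun_test phi : continuous phi -> (forall x, ~ D x -> phi x = 0) ->
  C0_fun Om phi.
Proof.
move=> cphi phi0; split=> // [x Omx|e e0]; first by apply: phi0 => /sDOm.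
apply: (subclosed_compact _ cD).
  have -> : [set x | e <= `|phi x|] = (fun x => `|phi x|) @^-1` [set y | e <= y].
    by [].
  apply: closed_comp; last exact: closed_ge.
  move=> x _; apply: (@continuous_comp _ _ _ phi (fun y : R => `|y|)).
    exact: cphi.
  exact: norm_continuous.
move=> x /= ex; apply: subset_closure; apply: contrapT => /phi0 phix.
by move: ex; rewrite phix normr0 leNgt e0.
Qed.

Variables (mu_ : nat -> vmeasure dot Om) (mu : vmeasure dot Om).
Variables (u_ : nat -> 'rV[R]_d -> V) (p B : R) (i : 'I_(\dim {:V})).
Hypothesis lebD : (leb D < +oo)%E.
Hypothesis p1 : 1 < p.
Hypothesis mu_cvg : weak_star_cvg mu_ mu.
Hypothesis u_mu : forall j, has_density dot D (mu_ j) (u_ j).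
Hypothesis uB : forall j, (\int[leb]_(x in D) (`|c i (u_ j x)| `^ p)%:E <= B%:E)%E.

(** An [L^p] bound is an equiintegrability bound: it makes the densities, like
    the limit measure, insensitive to replacing the indicator of [A] by a
    continuous function that is close to it in measure. *)
Lemma weak_star_setwise A : measurable A -> A `<=` D ->
  c i (mu_ j A) @[j --> \oo] --> c i (mu A).
Proof.
move=> mA AD; have [m [_ /is_density_sub dmu]] := polar_density mu mOm.
have [gi gE] := density_coord mD i dmu.
have B0 : 0 <= B.
  by rewrite -lee_fin (le_trans _ (uB 0))// integral_ge0// => x _; rewrite lee_fin powR_ge0.
apply/cvgrPdist_le => e e0.
have e3 : 0 < e / 3 by rewrite divr_gt0.
have e6 : 0 < e / 6 by rewrite divr_gt0.
have [dm dm0 small_m] := integral_mul_small mD gi e3.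
(* With [t `^ (1 - p) = dt], the two terms of [integral_mul_small_Lp] are at most
   [e / 6] as soon as the test function has integral at most [e / 6 / t]. *)
pose dt := e / 6 / (B + 1); have dt0 : 0 < dt by rewrite divr_gt0//; lra.
pose t := dt `^ (1 - p)^-1; have t0 : 0 < t by rewrite powR_gt0.
pose del := Num.min dm (e / 6 / t).
have del0 : 0 < del by rewrite lt_min dm0 divr_gt0.
pose nu : {measure set 'rV[R]_d -> \bar R} := measure_add leb m.
have nuD : (nu D < +oo)%E.
  have -> : nu D = (leb D + m D)%E by exact: measure_addE.
  by rewrite lte_add_pinfty// -ge0_fin_numE// fin_num_measure.
have [phi [cphi phi01 phi0 phie]] := continuous_approximation oD nuD mA del0.
have mphi : measurable_fun D phi.
  by apply: measurable_funTS; exact: continuous_measurable_rV.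
pose psi x := `|\1_A x - phi x|.
have mpsi : measurable_fun D psi.
  by apply: measurableT_comp => //; exact: measurable_funB.
have psi01 x : D x -> 0 <= psi x <= 1.
  move=> _; have /andP[q0 q1] := phi01 x; rewrite normr_ge0/= ler_norml indicE.
  by case: (_ \in _) => /=; lra.
have A01 x : D x -> 0 <= (\1_A x : R) <= 1.
  by move=> _; rewrite indicE; case: (_ \in _) => /=; rewrite lexx ler01.
have [psi_leb psi_m] : (\int[leb]_(x in D) (psi x)%:E <= del%:E)%E /\
    (\int[m]_(x in D) (psi x)%:E <= del%:E)%E.
  move: phie; rewrite ge0_integral_measure_add//; last exact/measurable_EFinP.
  move=> h; split; apply: le_trans h.
    by rewrite leeDl// integral_ge0.
  by rewrite leeDr// integral_ge0.
have phiM x : `|phi x| <= 1 by have /andP[q0 q1] := phi01 x; rewrite ger0_norm.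
have IA (n : {measure set 'rV[R]_d -> \bar R}) (k : 'rV[R]_d -> R) :
    \int[n]_(x in D) (k x * \1_A x) = \int[n]_(x in A) k x.
  rewrite -[A in RHS](setIidr AD) Rintegral_mkcondr; apply: eq_Rintegral => x _.
  by rewrite patchE indicE; case: ifPn => _; rewrite ?mulr1 ?mulr0.
have em : `|c i (mu A) - c i (integral_against phi mu)| <= e / 3.
  rewrite (integral_against_coord i dmu mphi phiM phi0) -gE// -IA -lee_fin.
  apply: le_trans (integral_approx_error mD gi _ mphi A01 _) _ => //.
  apply: small_m => //; apply: le_trans psi_m _.
  by rewrite lee_fin ge_min lexx.
have ej j : `|c i (mu_ j A) - c i (integral_against phi (mu_ j))| <= e / 3.
  have [ui uE] := density_coord mD i (u_mu j).
  rewrite (integral_against_coord i (u_mu j) mphi phiM phi0) -uE// -IA -lee_fin.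
  apply: le_trans (integral_approx_error mD ui _ mphi A01 _) _ => //.
  have := integral_mul_small_Lp mD (integrable_measurable ui) mpsi psi01 t0
    (ltW p1) (uB j) psi_leb.
  move=> /le_trans; apply; rewrite lee_fin (_ : e / 3 = e / 6 + e / 6); last by field.
  rewrite lerD//.
    by rewrite -ler_pdivlMl// mulrC ge_min lexx orbT.
  rewrite powR_root ?(ltW dt0)//; last by rewrite lt_eqF// subr_lt0.
  by rewrite /dt mulrAC ler_pdivrMr ?ler_wpM2l ?(ltW e6)//; lra.
have [C C0 cC] := coord_bound dot.
have eC : 0 < e / 3 / C by rewrite divr_gt0.
have /cvgrPdist_le/(_ _ eC) := mu_cvg (C0_fun_test cphi phi0).
apply: filterS => j; rewrite sub0r normrN (ger0_norm (dnorm_nneg _ _)) => hj.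
have : `|c i (integral_against phi (mu_ j)) - c i (integral_against phi mu)| <= e / 3.
  rewrite -linearB (le_trans (cC _ _))// -ler_pdivlMl//.
  by rewrite mulrC.
move=> hphi; apply: (ler_dist3 em _ _); last by rewrite distrC; exact: ej.
by rewrite distrC.
Qed.

End weak_star.

(** * Sequences bounded in Lp *)

Section Lp_bounded_sequences.
Context {R : realType} {d : nat} {V : vectType R}.
Variables (dot : {dot V for idfun}) (D : set 'rV[R]_d) (p : R).
Hypothesis mD : measurable D.
Hypothesis lebD : (lebesgue_rV R d D < +oo)%E.
Implicit Types (f g : 'rV[R]_d -> V) (u : nat -> 'rV[R]_d -> V) (q B : R).

Local Notation dnorm := (dnorm dot).
Local Notation c i := (coord (vbasis {:V}) i).
Local Notation leb := (lebesgue_rV R d).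

Lemma Lp_bounded_equiintegrable u q B :
  (forall j, vmeasurable dot D (u j)) ->
  (forall j, (\int[leb]_(x in D) (dnorm (u j x) `^ p)%:E <= B%:E)%E) ->
  0 <= q < p -> equiintegrable D (fun j x => dnorm (u j x) `^ q).
Proof.
move=> mu uB /andP[q0 qp]; have mn j := measurable_dnorm (mu j).
have n0 j x : D x -> 0 <= dnorm (u j x) by rewrite dnorm_nneg.
have absE A j : (\int[leb]_(x in A) `|dnorm (u j x) `^ q|%:E =
    \int[leb]_(x in A) (dnorm (u j x) `^ q)%:E)%E.
  by apply: eq_integral => x _; rewrite ger0_norm ?powR_ge0.
have B0 : 0 <= B.
  by rewrite -lee_fin (le_trans _ (uB 0))// integral_ge0// => x _; rewrite lee_fin powR_ge0.
split.
  exists (fine (leb D) + B) => j; rewrite absE.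
  apply: le_trans (integral_powR_interp mD (mn j) (n0 j) ltr01 q0 (ltW qp) (uB j)) _.
  by rewrite !powR1 !mul1e EFinD -ge0_measure_fin.
(* With [t `^ (q - p) = dt] the second term of the estimate is at most [e / 3]. *)
move=> e e0; pose dt := e / 3 / (B + 1).
have dt0 : 0 < dt by rewrite !divr_gt0//; lra.
pose t := dt `^ (q - p)^-1; have t0 : 0 < t by rewrite powR_gt0.
have tq0 : 0 < t `^ q by rewrite powR_gt0.
exists (e / 3 / t `^ q); first by rewrite !divr_gt0.
move=> j A mA AD Adel; rewrite absE.
have uBA : (\int[leb]_(x in A) (dnorm (u j x) `^ p)%:E <= B%:E)%E.
  apply: le_trans (uB j); apply: ge0_subset_integral => //.
    by apply/measurable_EFinP; exact: measurable_fun_powR.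
  by move=> x _; rewrite lee_fin powR_ge0.
have mnA : measurable_fun A (fun x => dnorm (u j x)) by exact: measurable_funS (mn j).
apply: le_lt_trans (integral_powR_interp mA mnA _ t0 q0 (ltW qp) uBA) _.
  by move=> x /AD; exact: n0.
apply: (@le_lt_trans _ _ (e / 3 + e / 3)%:E); last by rewrite lte_fin; lra.
rewrite EFinD leeD//.
  apply: (@le_trans _ _ ((t `^ q)%:E * (e / 3 / t `^ q)%:E)%E).
    by rewrite lee_wpmul2l ?(ltW Adel)// lee_fin ltW.
  by rewrite -EFinM lee_fin mulrCA divff ?mulr1// gt_eqF.
rewrite -EFinM lee_fin powR_root ?(ltW dt0)//; last by rewrite lt_eqF// subr_lt0.
by rewrite /dt mulrAC ler_pdivrMr ?ler_wpM2l//; lra.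
Qed.

Lemma coord_Lp_bound u B : 0 <= p ->
  (forall j, vmeasurable dot D (u j)) ->
  (forall j, (\int[leb]_(x in D) (dnorm (u j x) `^ p)%:E <= B%:E)%E) ->
  exists B', forall i j, (\int[leb]_(x in D) (`|c i (u j x)| `^ p)%:E <= B'%:E)%E.
Proof.
move=> p0 mu uB; have [C C0 cC] := coord_bound dot.
exists (C `^ p * B) => i j; have mn := measurable_dnorm (mu j).
have mc : measurable_fun D (fun x => c i (u j x)).
  by move: (mu j) => /vmeasurableP; exact.
apply: (@le_trans _ _ (\int[leb]_(x in D) (C `^ p * dnorm (u j x) `^ p)%:E)%E).
  apply: ge0_integral_EFin_le => //.
  - exact: measurable_fun_norm_powR.
  - by apply: measurable_funM => //; exact: measurable_fun_powR.
  - move=> x _; rewrite powR_ge0/= -powRM ?(ltW C0) ?dnorm_nneg//.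
    by rewrite ge0_ler_powR ?nnegrE ?mulr_ge0 ?(ltW C0) ?dnorm_nneg.
rewrite ge0_integral_EFinZ ?powR_ge0//; last 2 first.
- exact: measurable_fun_powR.
- by move=> x _; exact: powR_ge0.
by rewrite EFinM lee_wpmul2l// lee_fin powR_ge0.
Qed.

Lemma in_Lp_coord f : 0 < p -> vmeasurable dot D f ->
  (forall i, (\int[leb]_(x in D) (`|c i (f x)| `^ p)%:E < +oo)%E) ->
  (\int[leb]_(x in D) (dnorm (f x) `^ p)%:E < +oo)%E.
Proof.
move=> p0 mf fp; have mn := measurable_dnorm mf.
have mc i : measurable_fun D (fun x => c i (f x)) by move: mf => /vmeasurableP; exact.
pose P (h : 'rV[R]_d -> R) := [/\ measurable_fun D h, forall x, 0 <= h x &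
  (\int[leb]_(x in D) (h x `^ p)%:E < +oo)%E].
pose s (r : seq 'I_(\dim {:V})) x :=
  \sum_(i <- r) `|c i (f x)| * dnorm (vbasis {:V})`_i.
have ps (x r : R) : 0 <= x `^ r by exact: powR_ge0.
have Ps r : P (s r).
  elim: r => [|i r [ms s0 soo]].
    have -> : s [::] = cst 0 by apply/funext => x; rewrite /s big_nil.
    split=> //; rewrite (eq_integral (cst 0%E)) ?integral0// => x _ /=.
    by rewrite powR0// gt_eqF.
  pose a x := `|c i (f x)| * dnorm (vbasis {:V})`_i.
  have ma : measurable_fun D a.
    by apply: measurable_funM => //; exact: measurableT_comp.
  have a0 x : 0 <= a x by rewrite mulr_ge0 ?dnorm_nneg.
  have aoo : (\int[leb]_(x in D) (a x `^ p)%:E < +oo)%E.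
    rewrite (eq_integral (fun x =>
      (dnorm (vbasis {:V})`_i `^ p * `|c i (f x)| `^ p)%:E)); last first.
      by move=> x _; rewrite /a powRM ?dnorm_nneg// mulrC.
    rewrite ge0_integral_EFinZ//; first by rewrite lte_mul_pinfty ?lee_fin.
    exact: measurable_fun_norm_powR.
  have sE x : s (i :: r) x = a x + s r x by rewrite /s big_cons.
  have map : measurable_fun D (fun x => a x `^ p) by exact: measurable_fun_powR.
  have msp : measurable_fun D (fun x => s r x `^ p) by exact: measurable_fun_powR.
  split.
  - by rewrite (_ : s _ = fun x => a x + s r x); [exact: measurable_funD|exact/funext].
  - by move=> x; rewrite sE addr_ge0.
  - apply: (@le_lt_trans _ _ (\int[leb]_(x in D) (2 `^ p * (a x `^ p + s r x `^ p))%:E)%E).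
      apply: ge0_integral_EFin_le => //.
      + rewrite (_ : (fun x => _) = fun x => (a x + s r x) `^ p).
          by apply: measurable_fun_powR; exact: measurable_funD.
        by apply/funext => x; rewrite sE.
      + by apply: measurable_funM => //; exact: measurable_funD.
      + by move=> x _; rewrite powR_ge0 sE powRD_le ?(ltW p0).
    rewrite ge0_integral_EFinZ//; last 2 first.
    + exact: measurable_funD.
    + by move=> x _; rewrite addr_ge0.
    by rewrite lte_mul_pinfty ?lee_fin// ge0_integral_EFinD// lte_add_pinfty.
have [ms s0 soo] := Ps (index_enum _).
apply: le_lt_trans soo; apply: ge0_integral_EFin_le => //.
- exact: measurable_fun_powR.
- exact: measurable_fun_powR.
- move=> x _; rewrite powR_ge0/= ge0_ler_powR ?nnegrE ?dnorm_nneg ?(ltW p0)//.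
  exact: dnorm_coord.
Qed.

(** The exponent conjugate to [q], which is infinite for [q = 1], exceeds the one
    conjugate to [p], and [D] has finite measure. So weak convergence in [L^q]
    follows from weak convergence in [L^p]. *)
Lemma in_dual_Lp q g : 1 <= q < p -> in_Lp dot D (hoelder_conjugate q%:E) g ->
  (\int[leb]_(x in D) (dnorm (g x) `^ (p / (p - 1)))%:E < +oo)%E.
Proof.
move=> /andP[q1 qp] [mg goo]; have mn := measurable_dnorm mg.
have p1 : 1 < p by exact: le_lt_trans qp.
have p'0 : 0 < p / (p - 1) by rewrite divr_gt0 ?subr_gt0// (lt_trans _ p1).
move: q1; rewrite le_eqVlt => /predU1P[qE|q1].
  move: goo; rewrite -qE hoelder_conjugate1 /Lp_norm unlock.
  set G := (fun x => _) \_ D => goo.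
  have [N gN] : exists N : R, {ae leb, forall x, D x -> dnorm (g x) <= N}.
    move: goo; case: ifPn => [leb0 goo|]; last first.
      rewrite -leNgt => leb0 _; exists 0; exists setT; split=> //.
      by apply/eqP; rewrite eq_le leb0 measure_ge0.
    have [N GN] : exists N : R, (ess_sup leb (abse \o G) <= N%:E)%E.
      move: goo; case: (ess_sup _ _) => [N _|//|_].
        by exists N; exact: lexx.
      by exists 0; exact: leNye.
    exists N; apply: filterS (ess_sup_ge leb (abse \o G)) => x Gx Dx.
    rewrite -lee_fin (le_trans _ GN)// (le_trans _ Gx)// /G /= patchE mem_set//.
    by rewrite gee0_abs// lee_fin dnorm_nneg.
  apply: (@le_lt_trans _ _ (\int[leb]_(x in D) (`|N| `^ (p / (p - 1)))%:E)%E).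
    apply: ae_ge0_le_integral => //.
    - by move=> x _; rewrite lee_fin powR_ge0.
    - by apply/measurable_EFinP; exact: measurable_fun_powR.
    - apply: filterS gN => x gN Dx; rewrite lee_fin ge0_ler_powR ?(ltW p'0)//.
      + by rewrite nnegrE dnorm_nneg.
      + by rewrite (le_trans (gN Dx))// ler_norm.
  by rewrite integral_EFin_cst// lte_mul_pinfty ?lee_fin ?powR_ge0.
have q'E : hoelder_conjugate q%:E = (q / (q - 1))%:E.
  rewrite /hoelder_conjugate/= gt_eqF ?lte_fin ?(lt_trans ltr01)//.
  by rewrite inver subr_eq0 gt_eqF.
have q'0 : 0 < q / (q - 1) by rewrite divr_gt0 ?subr_gt0// (lt_trans _ q1).
have [_ goo'] : vmeasurable dot D g /\
    (\int[leb]_(x in D) (dnorm (g x) `^ (q / (q - 1)))%:E < +oo)%E.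
  by apply/in_LpP => //; rewrite -q'E.
apply: (Lp_sub mD lebD mn _ (ltW p'0) _ goo'); first by move=> x _; exact: dnorm_nneg.
rewrite ler_pdivrMr ?subr_gt0// mulrAC ler_pdivlMr ?subr_gt0//.
by rewrite !mulrBr !mulr1 [q * p]mulrC lerB// ltW.
Qed.

End Lp_bounded_sequences.

(** * Limits of the densities *)

Lemma cvg_finite_sum (R : realType) (I : finType) (f : I -> nat -> R) (l : I -> R) :
  (forall i, f i j @[j --> \oo] --> l i) ->
  (\sum_i f i j) @[j --> \oo] --> \sum_i l i.
Proof.
move=> fl; elim: (index_enum I) => [|i s ih].
  by rewrite big_nil; under eq_fun do rewrite big_nil; exact: cvg_cst.
by rewrite big_cons; under eq_fun do rewrite big_cons; exact: cvgD.
Qed.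

Section finite_sums.
Context d (T : measurableType d) (R : realType).
Variables (m : {measure set T -> \bar R}) (D : set T).
Hypothesis mD : measurable D.

Lemma Rintegral_sum (I : finType) (f : I -> T -> R) :
  (forall i, m.-integrable D (EFin \o f i)) ->
  \int[m]_(x in D) (\sum_i f i x) = \sum_i \int[m]_(x in D) f i x.
Proof.
move=> fi; rewrite /Rintegral.
under eq_integral do rewrite -sumEFin.
rewrite integral_sum// -[RHS]/(fine _%:E) -sumEFin; congr fine.
by apply: eq_bigr => i _; rewrite EFin_Rintegral.
Qed.

Lemma integrable_mul_Lp (k g : T -> R) (p p' : R) :
  1 <= p -> 1 <= p' -> p^-1 + p'^-1 = 1 ->
  measurable_fun D k -> measurable_fun D g ->
  (\int[m]_(x in D) (`|k x| `^ p)%:E < +oo)%E ->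
  (\int[m]_(x in D) (`|g x| `^ p')%:E < +oo)%E ->
  m.-integrable D (EFin \o (fun x => k x * g x)).
Proof.
move=> p1 p'1 pp' mk mg koo goo.
apply: (@integrable_le _ _ _ _ _ mD _ (fun x => `|k x| `^ p + `|g x| `^ p')).
- exact: measurable_funM.
- have := integrableD mD (integrable_norm_powR mk koo) (integrable_norm_powR mg goo).
  by apply: eq_integrable.
- move=> x _; rewrite normrM.
  have := @young_param _ `|k x| `|g x| 1 p p' (normr_ge0 _) (normr_ge0 _) ltr01 p1 p'1 pp'.
  by rewrite invr1 !powR1 !mul1r.
Qed.

End finite_sums.

Section convergence_of_densities.
Context {R : realType} {d : nat} {V : vectType R}.
Variables (dot : {dot V for idfun}) (Om D : set 'rV[R]_d) (p q B : R).
Variables (mu : nat -> vmeasure dot Om) (u : nat -> 'rV[R]_d -> V).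
Hypothesis oOm : open Om.
Hypothesis oD : open D.
Hypothesis cD : compact (closure D).
Hypothesis DOm : closure D `<=` Om.
Hypothesis lebD : (lebesgue_rV R d D < +oo)%E.
Hypothesis q1 : 1 <= q.
Hypothesis qp : q < p.
Hypothesis u_mu : forall j, has_density dot D (mu j) (u j).
Hypothesis uB :
  forall j, (\int[lebesgue_rV R d]_(x in D) (dnorm dot (u j x) `^ p)%:E <= B%:E)%E.

Local Notation dnorm := (dnorm dot).
Local Notation c i := (coord (vbasis {:V}) i).
Local Notation leb := (lebesgue_rV R d).

Let mD : measurable D. Proof. exact: mx_open_measurable. Qed.
Let mOm : measurable Om. Proof. exact: mx_open_measurable. Qed.
Let p1 : 1 < p. Proof. exact: le_lt_trans qp. Qed.
Let p0 : 0 < p. Proof. exact: lt_trans p1. Qed.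
Let p' := p / (p - 1).
Let p'1 : 1 <= p'.
Proof. by rewrite /p' ler_pdivlMr ?subr_gt0// mul1r lerBlDr lerDl ler01. Qed.
Let pp' : p^-1 + p'^-1 = 1.
Proof. by rewrite /p'; field; rewrite subr_eq0 !gt_eqF. Qed.
Let q0 : 0 < q. Proof. exact: lt_le_trans q1. Qed.
Let mu_ j : vmeasurable dot D (u j). Proof. by case: (u_mu j). Qed.
Let n0 (h : 'rV[R]_d -> V) x : D x -> 0 <= dnorm (h x).
Proof. by rewrite dnorm_nneg. Qed.

Let coordB : exists B', forall i j,
  (\int[leb]_(x in D) (`|c i (u j x)| `^ p)%:E <= B'%:E)%E.
Proof. exact: coord_Lp_bound (ltW p0) mu_ uB. Qed.

(** Setwise convergence gives the density; its coordinates are then weak limits in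
    [L^p] of those of the [u j], and of any other densities [w j]. *)
Lemma weak_star_limit_density (nu : vmeasure dot Om) : weak_star_cvg mu nu ->
  exists v, [/\ has_density dot D nu v, in_Lp dot D q%:E v &
    forall w : nat -> 'rV[R]_d -> V, (forall j, has_density dot D (mu j) (w j)) ->
      weak_Lp_cvg dot D q w v].
Proof.
move=> mu_nu; have [B' cB] := coordB.
have setwise A i : measurable A -> A `<=` D ->
    c i (mu j A) @[j --> \oo] --> c i (nu A).
  move=> mA AD.
  exact: (weak_star_setwise oOm oD cD DOm lebD p1 mu_nu u_mu (cB i) mA AD).
(* A setwise limit of measures vanishing on Lebesgue null sets vanishes there. *)
have [v vd] : exists v, is_density dot nu leb D v.
  apply: vmeasure_density => // A mA AD A0; apply: (@eq_coord _ _) => i.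
  rewrite linear0; have /cvg_lim <- // := setwise A i mA AD.
  apply: lim_near_cst => //; apply: nearW => j.
  have [ui uE] := density_coord mD i (u_mu j).
  rewrite -uE// /Rintegral null_set_integral//.
  exact: measurable_int (integrableS mD mA AD ui).
have [mv _ _] := vd.
have vB i : (\int[leb]_(x in D) (`|c i (v x)| `^ p)%:E <= B'%:E)%E.
  have [vi vE] := density_coord mD i vd.
  apply: (@weak_limit_Lp_bound _ _ _ leb D p p' B'
    (fun j x => c i (u j x)) (fun x => c i (v x)) mD lebD p1 p'1 pp') => //.
  - by move=> j; have [] := density_coord mD i (u_mu j).
  - move=> A mA AD; rewrite vE//.
    under eq_fun do rewrite (proj2 (density_coord mD i (u_mu _)) A mA AD).
    exact: setwise.
have vLp : (\int[leb]_(x in D) (dnorm (v x) `^ p)%:E < +oo)%E.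
  by apply: in_Lp_coord => // i; exact: le_lt_trans (vB i) (ltry _).
exists v; split=> //.
  apply/in_LpP => //; split=> //.
  by apply: Lp_sub vLp => //; [exact: measurable_dnorm|exact: n0|exact: ltW|exact: ltW].
move=> w wd g gq; have [mg _] := gq.
have goo : (\int[leb]_(x in D) (dnorm (g x) `^ p')%:E < +oo)%E.
  by apply: in_dual_Lp gq => //; rewrite q1 qp.
have mw j : vmeasurable dot D (w j) by case: (wd j).
have wB j : (\int[leb]_(x in D) (dnorm (w j x) `^ p)%:E <= B%:E)%E.
  by rewrite (density_integral_powR mD p (wd j) (u_mu j)).
have [B2 cwB] := coord_Lp_bound mD (ltW p0) mw wB.
pose ga i x := dot (vbasis {:V})`_i (g x).
have mga i : measurable_fun D (ga i).
  by apply: eq_measurable_fun (mg (vbasis {:V})`_i) => x _; exact: dotC.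
have gaoo i : (\int[leb]_(x in D) (`|ga i x| `^ p')%:E < +oo)%E.
  have mgp : measurable_fun D (fun x => dnorm (g x) `^ p').
    by apply: measurable_fun_powR; exact: measurable_dnorm.
  apply: (@le_lt_trans _ _
      (\int[leb]_(x in D) (dnorm (vbasis {:V})`_i `^ p' * dnorm (g x) `^ p')%:E)%E).
    apply: ge0_integral_EFin_le => //.
    - exact: measurable_fun_norm_powR.
    - exact: measurable_funM.
    - move=> x _; rewrite powR_ge0/= -powRM ?dnorm_nneg//.
      apply: ge0_ler_powR; [exact: le_trans p'1| | |exact: cauchy_schwarz].
        by rewrite nnegrE.
      by rewrite nnegrE mulr_ge0 ?dnorm_nneg.
  rewrite ge0_integral_EFinZ ?powR_ge0//.
    by rewrite lte_mul_pinfty ?lee_fin ?powR_ge0.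
  by move=> x _; exact: powR_ge0.
have sumE (h : 'rV[R]_d -> V) : vmeasurable dot D h ->
    (forall i, (\int[leb]_(x in D) (`|c i (h x)| `^ p)%:E < +oo)%E) ->
    \int[leb]_(x in D) dot (h x) (g x) =
    \sum_(i < \dim {:V}) \int[leb]_(x in D) (c i (h x) * ga i x).
  move=> mh hoo; rewrite -Rintegral_sum//; last first.
    move=> i; apply: (integrable_mul_Lp mD (ltW p1) p'1 pp') => //.
    by move: mh => /vmeasurableP; exact.
  by apply: eq_Rintegral => x _; rewrite dot_coord.
have cvoo i : (\int[leb]_(x in D) (`|c i (v x)| `^ p)%:E < +oo)%E.
  exact: le_lt_trans (vB i) (ltry _).
rewrite /weak_Lp_cvg sumE//.
under eq_fun do rewrite (sumE _ (mw _) (fun i => le_lt_trans (cwB i _) (ltry _))).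
apply: cvg_finite_sum => i; have [vi vE] := density_coord mD i vd.
apply: (@weak_cvg_Lp _ _ _ leb D p p' B2
    (fun j x => c i (w j x)) (fun x => c i (v x)) mD lebD p1 p'1 pp') => //.
- by move=> j; have [] := density_coord mD i (wd j).
- move=> A mA AD; rewrite vE//.
  under eq_fun do rewrite (proj2 (density_coord mD i (wd _)) A mA AD).
  exact: setwise.
Qed.

(** Both kinds of convergence give convergence of [|u j - v|] to [0] in measure, and
    the [L^p] bound, which [v] inherits, upgrades it to [L^q]. *)
Lemma strong_limit_density (v : 'rV[R]_d -> V) : vmeasurable dot D v ->
  cvg_in_measure dot D u v \/ cvg_ae dot D u v ->
  in_Lp dot D q%:E v /\ strong_Lp_cvg dot D q u v.
Proof.
move=> mv cv.
have mnv := measurable_dnorm mv.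
have mnu j := measurable_dnorm (mu_ j).
pose w j x := dnorm (u j x - v x).
have mw j : measurable_fun D (w j).
  by apply: measurable_dnorm; exact: vmeasurableB.
have w0 j x : D x -> 0 <= w j x by rewrite dnorm_nneg.
have wm (e : R) : 0 < e -> leb (D `&` [set x | e < w j x]) @[j --> \oo] --> 0%E.
  case: cv => [cm|cae] e0; first exact: cm.
  exact: ae_cvg_in_measure.
have vB : (\int[leb]_(x in D) (dnorm (v x) `^ p)%:E <= (2 `^ p)%:E * (B%:E + leb D))%E.
  apply: (@Lp_bound_in_measure _ _ _ leb D mD _ (fun j x => dnorm (u j x)) w) => //.
  - exact: n0.
  - by move=> j; exact: n0.
  - move=> j x _; rewrite -[v x in leLHS](subKr (u j x)).
    by rewrite (le_trans (ler_dnormD _ _ _))// dnorm_opp.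
have vLp : (\int[leb]_(x in D) (dnorm (v x) `^ p)%:E < +oo)%E.
  apply: le_lt_trans vB _.
  by rewrite lte_mul_pinfty ?lee_fin ?powR_ge0// lte_add_pinfty// ltry.
split.
  apply/in_LpP => //; split=> //.
  by apply: Lp_sub vLp => //; [exact: n0|exact: ltW|exact: ltW].
have mup j : measurable_fun D (fun x => dnorm (u j x) `^ p) by exact: measurable_fun_powR.
have mvp : measurable_fun D (fun x => dnorm (v x) `^ p) by exact: measurable_fun_powR.
have ps (a r : R) : 0 <= a `^ r by exact: powR_ge0.
have [K KE] : exists K : R, (\int[leb]_(x in D) (dnorm (v x) `^ p)%:E = K%:E)%E.
  exists (fine (\int[leb]_(x in D) (dnorm (v x) `^ p)%:E)%E); rewrite fineK//.
  by rewrite ge0_fin_numE// integral_ge0// => x _; rewrite lee_fin.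
have wB j : (\int[leb]_(x in D) (w j x `^ p)%:E <= (2 `^ p * (B + K))%:E)%E.
  apply: (@le_trans _ _ (\int[leb]_(x in D)
      (2 `^ p * (dnorm (u j x) `^ p + dnorm (v x) `^ p))%:E)%E).
    apply: ge0_integral_EFin_le => //.
    - exact: measurable_fun_powR.
    - by apply: measurable_funM => //; exact: measurable_funD.
    - move=> x Dx; rewrite ps/=; apply: le_trans (powRD_le _ _ (ltW p0)).
      + rewrite ge0_ler_powR ?nnegrE ?addr_ge0 ?dnorm_nneg ?(ltW p0)//.
        by rewrite /w (le_trans (ler_dnormD _ _ _))// dnorm_opp.
      + exact: dnorm_nneg.
      + exact: dnorm_nneg.
  rewrite ge0_integral_EFinZ//; last 2 first.
  - exact: measurable_funD.
  - by move=> x _; rewrite addr_ge0.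
  by rewrite EFinM lee_wpmul2l ?lee_fin// ge0_integral_EFinD// KE EFinD leeD2r.
have wq := Lq_cvg_in_measure mD lebD mw w0 q0 qp wB wm.
apply: ge0_cvge0 => [j|e e0]; first exact: Lnorm_ge0.
have := cvge0_le wq (powR_gt0 q e0); apply: filterS => j.
by rewrite (Lp_norm_leP _ _ _ q0 (ltW e0)).
Qed.

End convergence_of_densities.

(** * Uniform bounds and the conclusion *)

(** The constant [B] bounds the [p]-th powers of the [L^p] norms of all the
    densities: for the densities that the hypothesis provides by assumption, for
    the others because densities are unique up to null sets. *)
Lemma uniform_Lp_bound (R : realType) (d k : nat) (V W : vectType R)
    (dotV : {dot V for idfun}) (dotW : {dot W for idfun})
    (A : pde_op d k V W) (L : {vspace V}) (p : R) (Om Om' : set 'rV[R]_d) (eps : R)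
    (mu_ : nat -> vmeasure dotV Om) (sigma_ : nat -> vmeasure dotW Om) (K : set V) :
  0 < p -> measurable Om -> measurable Om' ->
  higher_integrability dotV dotW A L p Om Om' eps ->
  (forall j, pde_eq A (mu_ j) (sigma_ j)) ->
  (ereal_sup [set variation_measure dotV (mu_ j) Om
                  + variation_measure dotW (sigma_ j) Om | j in [set: nat]]
     < +oo)%E ->
  convex_cone K -> cone_close dotV K L eps -> (forall j, polar_in (mu_ j) K) ->
  (forall j, exists u, has_density dotV Om' (mu_ j) u /\ in_Lp dotV Om' p%:E u) /\
  exists B : R, forall u_ : nat -> 'rV[R]_d -> V,
    (forall j, has_density dotV Om' (mu_ j) (u_ j)) -> forall j,
    (\int[lebesgue_rV R d]_(x in Om') (dnorm dotV (u_ j x) `^ p)%:E <= B%:E)%E.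
Proof.
move=> p0 mOm mOm' [C hi] pde sup_lty Kcone Kclose Kpolar.
have H j := hi (mu_ j) (sigma_ j) K (pde j) Kcone Kclose (Kpolar j).
split=> [j|]; first by have [u [ud uLp _]] := H j; exists u.
pose x j := (variation_measure dotV (mu_ j) Om + variation_measure dotW (sigma_ j) Om)%E.
have x0 j : (0 <= x j)%E.
  by rewrite adde_ge0// (le_trans _ (dnorm_le_variation _ mOm))// lee_fin dnorm_nneg.
set S := ereal_sup _ in sup_lty.
have xS j : (x j <= S)%E by apply: ereal_sup_ubound; exists j.
have Sfin : S \is a fin_num by rewrite ge0_fin_numE// (le_trans (x0 0%N)).
have S0 : 0 <= fine S by rewrite fine_ge0// (le_trans (x0 0%N)).
pose N := `|C| * fine S.
exists (N `^ p) => u_ ud j; have [v [vd _ vC]] := H j.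
rewrite (density_integral_powR mOm' p (ud j) vd) -Lp_norm_leP ?mulr_ge0//.
apply: le_trans vC _; apply: (@le_trans _ _ (`|C|%:E * x j)%E).
  by apply: lee_wpmul2r; [exact: x0|rewrite lee_fin ler_norm].
rewrite EFinM fineK//; apply: lee_wpmul2l; [by rewrite lee_fin|exact: xS].
Qed.

Theorem corollary1p6 (R : realType) (d k : nat) (V W : vectType R)
    (dotV : {dot V for idfun}) (dotW : {dot W for idfun})
    (A : pde_op d k V W) (L : {vspace V}) (p : R)
    (Om Om' : set 'rV[R]_d) (eps : R)
    (mu_ : nat -> vmeasure dotV Om) (sigma_ : nat -> vmeasure dotW Om)
    (K : set V) :
  [set` L] `&` wave_cone A = [set 0] ->
  1 <= p -> ((k < d)%N -> p < d%:R / (d - k)%:R) ->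
  open Om -> lipschitz_domain Om' -> compactly_contained Om' Om ->
  0 < eps -> higher_integrability dotV dotW A L p Om Om' eps ->
  (forall j, pde_eq A (mu_ j) (sigma_ j)) ->
  (ereal_sup [set variation_measure dotV (mu_ j) Om
                  + variation_measure dotW (sigma_ j) Om | j in [set: nat]]
     < +oo)%E ->
  convex_cone K -> cone_close dotV K L eps ->
  (forall j, polar_in (mu_ j) K) ->
  [/\ (* (i) *)
      (forall j, exists u, has_density dotV Om' (mu_ j) u /\
                           in_Lp dotV Om' p%:E u) /\
      (forall u_ : nat -> 'rV[R]_d -> V,
         (forall j, has_density dotV Om' (mu_ j) (u_ j)) ->
         forall q, 1 <= q < p ->
           equiintegrable Om' (fun j x => dnorm dotV (u_ j x) `^ q)),
      (* (ii) *)
      (forall mu : vmeasure dotV Om, weak_star_cvg mu_ mu ->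
         forall q, 1 <= q < p ->
         exists u, [/\ has_density dotV Om' mu u, in_Lp dotV Om' q%:E u &
           forall u_ : nat -> 'rV[R]_d -> V,
             (forall j, has_density dotV Om' (mu_ j) (u_ j)) ->
             weak_Lp_cvg dotV Om' q u_ u]) &
      (* (iii) *)
      (forall (u_ : nat -> 'rV[R]_d -> V) (u : 'rV[R]_d -> V),
         (forall j, has_density dotV Om' (mu_ j) (u_ j)) ->
         vmeasurable dotV Om' u ->
         cvg_in_measure dotV Om' u_ u \/ cvg_ae dotV Om' u_ u ->
         forall q, 1 <= q < p ->
           in_Lp dotV Om' q%:E u /\ strong_Lp_cvg dotV Om' q u_ u)].
Proof.
move=> _ p1 _ oOm [oOm' bOm' _ _] [cOm' sOm'] _ hi pde sup_lty Kcone Kclose Kpolar.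
have mOm : measurable Om by exact: mx_open_measurable.
have mOm' : measurable Om' by exact: mx_open_measurable.
have lebOm' := lebesgue_bounded bOm' mOm'.
have p0 : 0 < p by exact: lt_le_trans p1.
have [ex [B uB]] := uniform_Lp_bound p0 mOm mOm' hi pde sup_lty Kcone Kclose Kpolar.
have /choice[v vP] := ex.
have vd j : has_density dotV Om' (mu_ j) (v j) by case: (vP j).
split.
- split=> // u_ ud q /andP[q1 qp].
  apply: (@Lp_bounded_equiintegrable _ _ _ _ _ _ mOm' lebOm' u_ q B _ (uB u_ ud)).
    by move=> j; case: (ud j).
  by rewrite qp (le_trans _ q1).
- move=> mu mu_cvg q /andP[q1 qp].
  exact: (weak_star_limit_density oOm oOm' cOm' sOm' lebOm' q1 qp vd (uB v vd) mu_cvg).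
- move=> u_ u ud mu cvu q /andP[q1 qp].
  exact: (strong_limit_density oOm' lebOm' q1 qp ud (uB u_ ud) mu cvu).
Qed.
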